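(* Let $a>0$ and let $K\in L^\infty(\Omega_0)$ be real-valued with $\|K\|_{L^\infty(\Omega_0)}\,a^2<\tfrac12$. If $\mu_K$ is non-zero and non-negative in some bounded open subinterval $J\subset\mathbb{R}$, then there exists a positive constant $c_K$, depending on $a$ and properties of $K$, such that $$-f^{-1}\partial_1f^{-1}\partial_1+\mu_K\ \ge\ \frac{c_K}{1+\delta^2}$$ in the form sense on $L^2_f(\Omega_0)$, i.e. for all $\psi\in H_0^1(\Omega_0)$ $$\int_{\Omega_0}f^{-1}|\partial_1\psi|^2\,dx+\int_{\Omega_0}\mu_K(x_1)\,|\psi|^2f\,dx\ \ge\ c_K\int_{\Omega_0}\frac{|\psi(x)|^2}{1+\delta(x)^2}\,f(x)\,dx ,$$ where $\delta(x):=|x_1-x_1^0|$ with $x_1^0$ being the mid-point of $J$. As a consequence, the Hardy-type inequality $H_K-E_1\ge\rho>0$ holds with the positive function $\rho=c_K/(1+\delta^2)$, i.e. $$h_K[\psi]-E_1\|\psi\|_f^2\ \ge\ c_K\int_{\Omega_0}\frac{|\psi(x)|^2}{1+\delta(x)^2}\,f(x)\,dx\qquad\text{for all }\psi\in H_0^1(\Omega_0).$$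
   Context: $\Omega_0:=\mathbb{R}\times(-a,a)$, points are $x=(x_1,x_2)$. $K$ is represented by a measurable function with $|K|\le\|K\|_{L^\infty(\Omega_0)}$ everywhere. For each $x_1\in\mathbb{R}$, $f(x_1,\cdot)\in H^2((-a,a))$ is the solution of the Jacobi equation $\partial_2^2 f+Kf=0$ with $f(x_1,0)=1$, $\partial_2 f(x_1,0)=0$ (under the assumption $\|K\|_\infty a^2<1/2$, $f$ is bounded and uniformly positive on $\Omega_0$). $L^2_f(\Omega_0):=L^2(\Omega_0,f(x)\,dx)$ with norm $\|\psi\|_f^2:=\int_{\Omega_0}|\psi|^2f\,dx$; $h_K[\psi]:=\int_{\Omega_0}\big(f^{-1}|\partial_1\psi|^2+f|\partial_2\psi|^2\big)dx$ for $\psi\in H_0^1(\Omega_0)$, and $H_K$ is the self-adjoint operator in $L^2_f(\Omega_0)$ associated with $h_K$. $E_1:=(\pi/(2a))^2$. The function $\mu_K:\mathbb{R}\to\mathbb{R}$ (also regarded as the function $x\mapsto\mu_K(x_1)$ on $\Omega_0$) is $$\mu_K(x_1):=\inf_{\varphi\in H_0^1((-a,a))\setminus\{0\}}\frac{\int_{-a}^a|\dot\varphi(x_2)|^2f(x_1,x_2)\,dx_2}{\int_{-a}^a|\varphi(x_2)|^2f(x_1,x_2)\,dx_2}-E_1 .$$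
   Formalization: μ_K is assumed non-negative almost everywhere on ℝ, not only in J (the claim fails if μ_K is negative on a long interval away from J); ''non-zero in J'' means not almost everywhere zero on J. *)

(* Defs.v *)
From HB Require Import structures.
From mathcomp Require Import all_boot all_order all_algebra.
From mathcomp Require Import all_classical all_reals all_analysis.
From mathcomp.real_closed Require Import complex.

Set Implicit Arguments.
Unset Strict Implicit.
Unset Printing Implicit Defensive.

Import Order.TTheory GRing.Theory Num.Theory.
Import numFieldNormedType.Exports.

Local Open Scope classical_set_scope.
Local Open Scope ring_scope.

Section test_functions.
Context (R : realType) (V : normedModType R).
Implicit Types (phi : V -> R) (s : seq V).

Definition iter_derive s phi : V -> R :=
  foldr (fun v (g : V -> R) x => 'D_v g x) phi s.

(* In finite dimension this is C^oo: iterated directional derivatives of all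
   orders, in all directions, exist and are continuous. *)
Definition smooth phi := forall s,
  continuous (iter_derive s phi) /\
  forall x v, derivable (iter_derive s phi) x v.

Definition test_function (Om : set V) phi :=
  smooth phi /\
  exists A : set V,
    [/\ compact A, A `<=` Om & forall x, ~ A x -> phi x = 0].

End test_functions.

(* A Sobolev function comes with its weak gradient: [H10 u g] reads "u is in
   H^1_0(Om) and [g i] is the weak derivative of u along [D i]".  The
   derivations [D] only act on the smooth functions of [test], the instances
   below take for [test] the class C_c^oo(Om). *)
Section sobolev.
Context d (T : measurableType d) (R : realType).
Variables (mu : {measure set T -> \bar R}) (Om : set T) (test : set (T -> R)).
Context (I : Type) (D : I -> (T -> R) -> T -> R).
Implicit Types (u : T -> R) (g : I -> T -> R).

Definition sqL2norm u : \bar R := (\int[mu]_(x in Om) ((u x) ^+ 2)%:E)%E.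

Definition L2 u := measurable_fun Om u /\ (sqL2norm u < +oo)%E.

Definition weak_derivative i u (v : T -> R) := forall phi, test phi ->
  (\int[mu]_(x in Om) (u x * D i phi x)%:E =
   - \int[mu]_(x in Om) (v x * phi x)%:E)%E.

Definition H1 u g :=
  [/\ L2 u, forall i, L2 (g i) & forall i, weak_derivative i u (g i)].

Definition H10 u g := H1 u g /\
  exists phi : nat -> T -> R,
    [/\ forall n, test (phi n),
        sqL2norm (phi n \- u) @[n --> \oo] --> 0%E &
        forall i, sqL2norm (D i (phi n) \- g i) @[n --> \oo] --> 0%E].

(* H^1_0(Om; C) = H^1_0(Om; R) + i H^1_0(Om; R) *)
Definition H10C (u : T -> R[i]) (g : I -> T -> R[i]) :=
  H10 (fun x => complex.Re (u x)) (fun i x => complex.Re (g i x)) /\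
  H10 (fun x => complex.Im (u x)) (fun i x => complex.Im (g i x)).

End sobolev.

Section strip.
Context (R : realType).
Implicit Types (a : R) (K f : R * R -> R).

Definition sqmod (z : R[i]) : R := complex.Re z ^+ 2 + complex.Im z ^+ 2.

Definition leb1 := @lebesgue_measure R.
Definition leb2 := (@lebesgue_measure R \x @lebesgue_measure R)%E.

Definition section a : set R := `]- a, a[.
Definition strip a : set (R * R) := [set x | - a < x.2 < a].

Definition D1 (_ : unit) (phi : R -> R) : R -> R := fun t => 'D_1 phi t.

Definition basis2 (i : 'I_2) : R * R := if i == ord0 then (1, 0) else (0, 1).
Definition D2 (i : 'I_2) (phi : R * R -> R) : R * R -> R :=
  fun x => 'D_(basis2 i) phi x.

Definition H1_section a (u u' : R -> R) :=
  H1 leb1 (section a) (test_function (section a)) D1 u (fun=> u').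

Definition H10_section a (u u' : R -> R[i]) :=
  H10C leb1 (section a) (test_function (section a)) D1 u (fun=> u').

Definition H10_strip a (psi : R * R -> R[i]) (dpsi : 'I_2 -> R * R -> R[i]) :=
  H10C leb2 (strip a) (test_function (strip a)) D2 psi dpsi.

Definition normLoo a K : \bar R :=
  ('N[leb2]_(+oo)[EFin \o (K \_ (strip a))])%E.

(* y is the solution in H^2((-a,a)) of y'' + k y = 0, y(0) = 1, y'(0) = 0.
   For the pointwise initial conditions to make sense, y and y' = p are the
   continuous representatives. *)
Definition jacobi_solution a (k y : R -> R) := exists p q : R -> R,
  [/\ H1_section a y p, H1_section a p q,
      (forall t, section a t -> {for t, continuous y} /\ {for t, continuous p}),
      y 0 = 1 /\ p 0 = 0 &
      {ae leb1, forall t, section a t -> q t + k t * y t = 0}].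

Definition E1 a : R := (pi / (2 * a)) ^+ 2.

Definition muK a f (x1 : R) : R :=
  inf [set r | exists phi phi' : R -> R[i],
         [/\ H10_section a phi phi',
             ~ {ae leb1, forall t, section a t -> phi t = 0} &
             r = fine (\int[leb1]_(t in section a)
                         (sqmod (phi' t) * f (x1, t))%:E)%E /
                 fine (\int[leb1]_(t in section a)
                         (sqmod (phi t) * f (x1, t))%:E)%E]]
  - E1 a.

Definition sqnormf a f (psi : R * R -> R[i]) : \bar R :=
  (\int[leb2]_(x in strip a) (sqmod (psi x) * f x)%:E)%E.

(* the quadratic form h_K at psi, where dpsi is the weak gradient of psi *)
Definition hK a f (dpsi : 'I_2 -> R * R -> R[i]) : \bar R :=
  (\int[leb2]_(x in strip a)
     ((f x)^-1 * sqmod (dpsi ord0 x) + f x * sqmod (dpsi ord_max x))%:E)%E.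

End strip.

Arguments leb1 R : clear implicits.
Arguments leb2 R : clear implicits.

(* Main.v *)
(* Each slice f(x1, .) solves an integral equation; since
   |K| a^2 < 1/2 it stays between 1 - q and 1 + q with q < 1 and is Lipschitz
   uniformly in x1, and f is jointly measurable as a limit of Picard iterates.
   Hence mu_K is measurable, and mu_K >= eta on a set B of positive finite measure
   inside J.  For b in B, the ground state sqrt(1 + |x1 - b|) gives in one dimension
   int phi'^2 + phi(b)^2 >= 1/4 int phi^2 / (1 + |x1 - b|)^2; integrating over b in B
   turns the point value into int_B phi^2, which eta^-1 mu_K dominates.  Fibrewise,
   int f |d_2 psi|^2 >= (E_1 + mu_K) int f |psi|^2 by definition of mu_K.  Both
   inequalities are proved for test functions, integrated by Tonelli and extended to
   H^1_0 by L^2 limits, with mu_K replaced by the bounded function eta 1_B <= mu_K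
   until after the limit. *)

(* Measurability is the first obstacle. The hypotheses treat each slice of [f] separately, and [muK]
   is an infimum over an uncountable family. For [muK] the way out is stability: replacing a slice
   of [f] by one within a factor [lam] changes [muK + E1] by at most [lam ^+ 2]. Since [f] is
   bounded below, slices with the same finite rounded data are close in this multiplicative sense.
   Test functions come first because every slice of a test function is a test function, hence a
   competitor in the infimum defining [muK]. The passage to Sobolev functions then rests on Young's
   inequality, whose error term is controlled only for bounded weights; this is why [eta 1_B] stands
   in for [muK]. The sign and the non-vanishing of [muK] are known up to null sets, so no single
   good point [b] can be singled out; a point evaluation at [b] would also not survive an L^2 limit.
   Averaging over [b] in [B] settles both. The bound 1/2 is the threshold at which
   [q = th / (1 - th)] reaches 1, where [th] is the norm of [K] times [a ^+ 2]. *)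
From mathcomp Require Import all_boot all_order all_algebra.
From mathcomp Require Import all_classical all_reals all_analysis.
From mathcomp.real_closed Require Import complex.
From mathcomp Require Import measurable_realfun ring lra.
Require Import Defs.

Set Implicit Arguments.
Unset Strict Implicit.
Unset Printing Implicit Defensive.

Import Order.TTheory GRing.Theory Num.Theory.
Import numFieldNormedType.Exports.

Local Open Scope classical_set_scope.
Local Open Scope ring_scope.

(** * Smooth functions and cut-offs *)

Section smooth.
Context (R : realType) (V : normedModType R).

(** A class closed under all directional derivatives contains every iterated derivative of its
    members, so smoothness is proved below by exhibiting such a class rather than by induction on
    lists of directions. *)
Lemma smooth_coind (C : set (V -> R)) :
  (forall g, C g -> [/\ continuous g, forall x v, derivable g x v &
    forall v, C (fun x => 'D_v g x)]) -> C `<=` smooth (V := V).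
Proof.
move=> hC g Cg s; have : C (iter_derive s g).
  by elim: s => [//|v s ih] /=; have [_ _] := hC _ ih; exact.
by case/hC.
Qed.

Lemma smooth_continuous (g : V -> R) : smooth g -> continuous g.
Proof. by move=> /(_ [::])[]. Qed.

Lemma smooth_derivable (g : V -> R) x v : smooth g -> derivable g x v.
Proof. by move=> /(_ [::])[_]; exact. Qed.

Lemma smooth_derive (g : V -> R) v : smooth g -> smooth (fun x => 'D_v g x).
(* The last direction of the list is the first one applied. *)
Proof. by move=> sg s; have := sg (rcons s v); rewrite /iter_derive foldr_rcons. Qed.

Lemma smoothB (g h : V -> R) : smooth g -> smooth h -> smooth (g \- h).
Proof.
move=> sg sh; apply: (@smooth_coind
  [set k | exists g h : V -> R, [/\ smooth g, smooth h & k = g \- h]]); last first.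
  by exists g, h.
move=> _ [{sg}g [{sh}h [sg sh ->]]]; split.
- by move=> x; apply: cvgB; apply: smooth_continuous.
- by move=> x v; apply: derivableB; exact: smooth_derivable.
- move=> v; exists (fun x => 'D_v g x), (fun x => 'D_v h x); split.
  + exact: smooth_derive.
  + exact: smooth_derive.
  + apply/funext => x.
    by apply: (@deriveB _ _ _ g h x v); exact: smooth_derivable.
Qed.

Lemma smooth0 : smooth (fun _ : V => 0 : R).
Proof.
apply: (@smooth_coind [set fun _ : V => 0 : R]) => // _ ->; split.
- by move=> x; exact: cvg_cst.
- by move=> x v; exact: derivable_cst.
- by move=> v; apply/funext => x; exact: derive_cst.
Qed.

End smooth.

Section smooth_real.
Context (R : realType).
Implicit Types (g : R -> R).

Lemma is_derive_dir g (x df v : R) : is_derive x 1 g df ->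
  is_derive x v g (v * df).
Proof.
move=> gdf; have /derivable1_diffP dg : derivable g x 1 by [].
have gv : derivable g x v by exact: diff_derivable.
apply: DeriveDef => //; rewrite deriveE// -[v in LHS]mulr1 -[v * 1]/(v *: 1) linearZ/=.
by rewrite -deriveE// derive_val.
Qed.

(** On the line the derivative along [v] is [v] times the derivative along 1. Closing [C] under
    scalar multiples therefore leaves only the direction 1 to check. *)
Lemma smooth_coind1 (C : set (R -> R)) :
  (forall g, C g -> exists2 g', C g' & forall x : R, is_derive x 1 g (g' x)) ->
  C `<=` smooth (V := R).
Proof.
move=> hC g Cg; apply: (@smooth_coind _ _
   [set k : R -> R | exists c h, C h /\ k = (fun x => c * h x)]); last first.
  by exists 1, g; split => //; apply/funext => x; rewrite mul1r.
move=> _ [c [h [/hC[h' Ch' dh] ->]]].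
have dch x v : is_derive x v (fun x => c * h x) (c * (v * h' x)).
  by have := @is_deriveZ _ _ _ h c x v _ (is_derive_dir v (dh x)).
split.
- by move=> x; apply: differentiable_continuous; exact/derivable1_diffP.
- by [].
- move=> v; exists (c * v), h'; split=> //; apply/funext => x.
  by have := dch x v => ?; rewrite derive_val mulrA.
Qed.

Lemma smooth_is_derive g (x : R) : smooth g -> is_derive x 1 g ('D_1 g x).
Proof. by move=> sg; apply/derivableP/smooth_derivable. Qed.

Lemma is_derive_affine g (c d x dg : R) : is_derive (c * x + d) 1 g dg ->
  is_derive x 1 (fun y => g (c * y + d)) (c * dg).
Proof.
move=> gdg; have ax : is_derive x 1 (fun y => c * y + d) c.
  have := @is_deriveD _ _ _ _ _ x 1 _ _
    (@is_deriveZ _ _ _ id c x 1 _ (is_derive_id x 1)) (is_derive_cst d x 1).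
  by rewrite addr0 [c *: 1]mulr1.
by rewrite mulrC; exact: (@is_derive1_comp _ g (fun y => c * y + d)).
Qed.

Lemma smooth_affine g (c d : R) : smooth g -> smooth (fun x => g (c * x + d)).
Proof.
move=> sg; apply: (@smooth_coind1 [set k | exists k0 h, smooth h /\
    k = (fun x => k0 * h (c * x + d))]); last first.
  by exists 1, g; split => //; apply/funext => x; rewrite mul1r.
move=> _ [k0 [h [sh ->]]]; exists (fun x => (k0 * c) * 'D_1 h (c * x + d)).
  by exists (k0 * c), (fun x => 'D_1 h x); split => //; exact: smooth_derive.
move=> x; rewrite -mulrA.
by have := @is_deriveZ _ _ _ _ k0 x 1 _
  (is_derive_affine (smooth_is_derive (c * x + d) sh)).
Qed.

End smooth_real.

Section bump.
Context (R : realType).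
Implicit Types (P : {poly R}) (n : nat) (x : R).

(** The parameters make the family stable under differentiation; [bumpfun 1 0] is the usual bump exp
    (- 1 / (x (1 - x))) on (0, 1). *)
Definition bumpfun P n x : R := if 0 < x < 1 then
  P.[x] / (x * (1 - x)) ^+ n * expR (- (x * (1 - x))^-1) else 0.

Lemma expRN_inv_le n (w : R) : 0 < w -> expR (- w^-1) <= n.+1`!%:R * w ^+ n.+1.
Proof.
move=> w0; rewrite expRN invf_ple ?posrE ?expR_gt0//; last first.
  by rewrite mulr_gt0 ?exprn_gt0// ltr0n fact_gt0.
have := @expR_ge1Dxn R w^-1 n; rewrite invr_ge0 => /(_ (ltW w0)).
apply: le_trans; rewrite invfM exprVn mulrC ler_wpDl//.
Qed.

(** Flatness at and beyond the endpoints. With w = y (1 - y), the exponential is at most (n + 2)!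
    w^(n + 2), which beats the denominator w^n and leaves w^2; and w is at most the distance from y
    to any point outside (0, 1). *)
Lemma bumpfun_le P n : exists C, forall x y, ~~ (0 < x < 1) ->
  `|bumpfun P n y| <= C * (y - x) ^+ 2.
Proof.
have [c _ hc] := @EVT_max R (fun x => `|P.[x]|) 0 1 ler01
  (@continuous_subspaceT _ _ _ _ (fun x => cvg_norm (@continuous_horner R P x))).
pose M : R := `|P.[c]|; rewrite -/M in hc; have M0 : 0 <= M by exact: normr_ge0.
exists (M * n.+2`!%:R) => x y hx; rewrite /bumpfun.
case: ifPn => [/andP[y0 y1]|_]; last first.
  by rewrite normr0 mulr_ge0 ?sqr_ge0// mulr_ge0 ?ler0n.
set w := y * (1 - y).
have w0 : 0 < w by rewrite mulr_gt0// subr_gt0.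
have /hc PM : y \in `[0, 1]%R by rewrite in_itv/= !ltW.
rewrite !normrM normfV (ger0_norm (expR_ge0 _)) (ger0_norm (exprn_ge0 _ (ltW w0))).
have h2 := expRN_inv_le n.+1 w0.
apply: (@le_trans _ _ (M * (n.+2`!%:R * w ^+ 2))).
  rewrite -mulrA ler_pM// ?mulr_ge0 ?invr_ge0 ?exprn_ge0 ?expR_ge0 ?(ltW w0)//.
  rewrite ler_pdivrMl ?exprn_gt0// (le_trans h2)//.
  by rewrite [leRHS]mulrCA ler_wpM2l ?ler0n// -exprD addn2.
rewrite -mulrA ler_wpM2l// ler_wpM2l ?ler0n//.
move: hx; rewrite negb_and -!leNgt => /orP[hx|hx].
  rewrite ler_sqr ?nnegrE; [|exact: ltW|lra].
  by rewrite /w; nra.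
rewrite -[leRHS]sqrrN ler_sqr ?nnegrE; [|exact: ltW|lra].
by rewrite /w; nra.
Qed.

Lemma is_derive_quadratic (g : R -> R) (C x : R) :
  (forall y, `|g y| <= C * (y - x) ^+ 2) -> is_derive x 1 g 0.
Proof.
move=> gC.
have gx : g x = 0.
  by apply/eqP; rewrite -normr_eq0 eq_le normr_ge0 (le_trans (gC x))// subrr expr0n mulr0.
have C0 : 0 <= C.
  by have := le_trans (normr_ge0 _) (gC (x + 1)); rewrite addrAC subrr add0r expr1n mulr1.
have cv : h^-1 *: ((g \o shift x) (h *: 1) - g x) @[h --> 0^'] --> (0 : R).
  apply/cvgrPdist_lt => e e0; near=> h.
  have h0 : h != 0 by near: h; exact: nbhs_dnbhs_neq.
  rewrite sub0r normrN gx subr0 /= [h *: 1]mulr1 normrM normfV.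
  apply: (@le_lt_trans _ _ (C * `|h|)).
    rewrite ler_pdivrMl ?normr_gt0// (le_trans (gC _))// addrK.
    by rewrite [leRHS]mulrCA -normrM -expr2 (ger0_norm (sqr_ge0 _)).
  have : `|h| < e / (C + 1).
    near: h; apply: dnbhs0_lt; rewrite divr_gt0// ltr_wpDl//.
  rewrite ltr_pdivlMr ?ltr_wpDl// => he; apply: le_lt_trans he.
  by rewrite mulrC ler_wpM2l// lerDl.
apply: DeriveDef; first by apply/cvg_ex; exists 0.
exact: cvg_lim cv.
Unshelve. all: by end_near. Qed.

(** With w = x (1 - x), differentiating P w^(-n) exp (- 1 / w) gives the numerator P' w^2 + w' P (1
    - n w) over w^(n + 2). At the other points the quadratic bound of [bumpfun_le] forces the
    derivative to be 0. *)
Lemma is_derive_bumpfun P n x : is_derive x 1 (bumpfun P n)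
  (bumpfun ((P^`() * ('X * (1 - 'X)) ^+ 2 + (1 - 'X *+ 2) * P
     * (1 - n%:R *: ('X * (1 - 'X))))) n.+2 x).
Proof.
have [x01|x01] := boolP (0 < x < 1); last first.
  rewrite {2}/bumpfun (negPf x01).
  by have [C hC] := bumpfun_le P n; apply: (@is_derive_quadratic _ C) => y; exact: hC.
have [x0 x1] := andP x01; rewrite {2}/bumpfun x01.
have w0 : x * (1 - x) != 0 by rewrite gt_eqF// mulr_gt0// subr_gt0.
pose w (y : R) := y * (1 - y).
have dw : is_derive x 1 w (1 - 2 * x).
  apply: (@is_derive_eq _ _ _ _ _ _ _ _
    (@is_deriveM _ _ id (fun y => 1 - y) x 1 _ _ (is_derive_id _ _)
     (is_deriveB (is_derive_cst (1 : R) x 1) (is_derive_id x 1)))).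
  by rewrite /= /GRing.scale/=; ring.
have dwV : is_derive x 1 (fun y => (w y)^-1) (- (w x) ^- 2 * (1 - 2 * x)).
  exact: (@is_deriveV R w x _ 1 w0 dw).
have dwVn : is_derive x 1 (fun y => ((w y)^-1) ^+ n)
   (n%:R * (w x)^-1 ^+ n.-1 * (- (w x) ^- 2 * (1 - 2 * x))).
  by have := @is_deriveX _ _ (fun y => (w y)^-1) n x 1 _ dwV; rewrite fctE.
have dexp : is_derive x 1 (fun y => expR (- (w y)^-1))
   (expR (- (w x)^-1) * (- (- (w x) ^- 2 * (1 - 2 * x)))).
  exact: (@is_derive1_comp _ expR (fun y => - (w y)^-1) x _ _
    (is_derive_expR _) (is_deriveN dwV)).
have dall := is_deriveM (is_deriveM (is_derive_poly P x) dwVn) dexp.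
apply: (@near_eq_is_derive _ _ _ (horner P * (fun y => ((w y)^-1) ^+ n) *
  (fun y => expR (- (w y)^-1)))%R).
- near=> y; rewrite /bumpfun ifT ?fctE ?exprVn//.
  have : y \in `]0, 1[ by near: y; apply: near_in_itvoo; rewrite in_itv.
  by rewrite in_itv.
- apply: (is_derive_eq dall).
  rewrite !hornerE /GRing.scale/= -/(w x).
  rewrite fctE; case: n {dwVn dall} => [|n] /=.
    by rewrite /w; field; rewrite subr_eq0 !gt_eqF.
  rewrite !exprVn !exprS; have : w x ^+ n != 0 by rewrite expf_neq0.
  by move: (w x ^+ n) => W W0; rewrite /w; field; rewrite W0 subr_eq0 !gt_eqF.
Unshelve. all: by end_near. Qed.

Lemma smooth_bumpfun P n : smooth (bumpfun P n).
Proof.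
apply: (@smooth_coind1 _ [set h | exists Q k, h = bumpfun Q k]); last by exists P, n.
move=> _ [Q [k ->]]; eexists; last by move=> x; exact: is_derive_bumpfun.
by do 2 eexists.
Qed.

End bump.

Section smooth_step.
Context (R : realType).
Let rho : R -> R := bumpfun 1 0.

Let rho0 x : ~~ (0 < x < 1) -> rho x = 0.
Proof. by rewrite /rho /bumpfun => /negPf ->. Qed.

Let rho_gt0 x : 0 < x < 1 -> 0 < rho x.
Proof. by move=> x01; rewrite /rho /bumpfun x01 hornerC expr0 divr1 mul1r expR_gt0. Qed.

Let rho_ge0 x : 0 <= rho x.
Proof. by have [/rho_gt0/ltW//|/rho0->] := boolP (0 < x < 1). Qed.

Let rho_continuous : continuous rho.
Proof. exact/smooth_continuous/smooth_bumpfun. Qed.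

Let rho_integrable : (leb1 R).-integrable setT (EFin \o rho).
Proof.
have -> : EFin \o rho = (EFin \o rho) \_ `[0, 1].
  apply/funext => x; rewrite patchE; case: ifPn => // x01 /=; congr EFin.
  apply: rho0; apply: contraNN x01 => /andP[x0 x1].
  by rewrite inE/= in_itv/= !ltW.
apply/(integrable_mkcond _ _).1 => //; apply: continuous_compact_integrable.
  exact: segment_compact.
exact: continuous_subspaceT.
Qed.

Let F x : R := \int[leb1 R]_(t in `]-oo, x]) rho t.

Let dF (x : R) : is_derive x 1 F (rho x).
Proof.
have [] := @continuous_FTC1 R rho -oo%O x (x + 1) _ _ _ (@rho_continuous x).
- by rewrite ltrDl.
- exact: integrableS rho_integrable.
- by rewrite ltNyr.
- by move=> dF; rewrite derive1E => <-; apply: DeriveDef.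
Qed.

Let mvt (x y : R) : x < y -> exists2 z, z \in `]x, y[ & F y - F x = rho z * (y - x).
Proof.
move=> xy; apply: MVT xy _ _ => [z _|]; first exact: dF.
apply: continuous_subspaceT => z; apply: differentiable_continuous.
by apply/derivable1_diffP; have [] := dF z.
Qed.

(** The step is the primitive of the bump, divided by the mass [F 1 - F 0]; this is positive because
    the mean value theorem makes it a value of the bump inside (0, 1). *)
Lemma smooth_step : exists eta : R -> R, [/\ smooth eta,
  (forall x, x <= 0 -> eta x = 0), (forall x, 1 <= x -> eta x = 1),
  (forall x, 0 <= 'D_1 eta x) & forall x, 0 <= eta x <= 1].
Proof.
have c0 : 0 < F 1 - F 0.
  by have [z z01 ->] := mvt ltr01; rewrite subr0 mulr1 rho_gt0.
set c := F 1 - F 0 in c0.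
pose eta x := c^-1 * (F x - F 0).
have deta (x : R) : is_derive x 1 eta (c^-1 * rho x).
  have := @is_deriveZ _ _ _ _ c^-1 x 1 _ (is_deriveB (dF x) (is_derive_cst (F 0) x 1)).
  by rewrite subr0.
have Fconst x y : x <= y -> (forall z, z \in `]x, y[ -> rho z = 0) -> F x = F y.
  rewrite le_eqVlt => /predU1P[->//|xy] h.
  have [z /h -> /eqP] := mvt xy.
  by rewrite mul0r subr_eq0 => /eqP.
have rho_le0 (x z : R) : z \in `]x, 0[ -> rho z = 0.
  by rewrite in_itv/= => /andP[_ z0]; rewrite rho0// negb_and -!leNgt (ltW z0).
have rho_ge1 (x z : R) : z \in `]1, x[ -> rho z = 0.
  by rewrite in_itv/= => /andP[z1 _]; rewrite rho0// negb_and -!leNgt (ltW z1) orbT.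
exists eta; split.
- apply: (@smooth_coind1 _ [set k | k = eta \/
    exists c P n, k = (fun x => c * bumpfun P n x)]); last by left.
  move=> k [->|[c' [P [n ->]]]].
    by exists (fun x => c^-1 * rho x) => //; right; do 3 eexists.
  eexists; last first.
    move=> x; exact: (@is_deriveZ _ _ _ _ c' x 1 _ (is_derive_bumpfun P n x)).
  by right; do 3 eexists.
- move=> x x0; rewrite /eta (Fconst x 0) ?subrr ?mulr0// => z; exact: rho_le0.
- move=> x x1; rewrite /eta -(Fconst 1 x)// ?mulVf ?gt_eqF// => z; exact: rho_ge1.
- move=> x; have := deta x => ?; rewrite derive_val mulr_ge0 ?invr_ge0 ?(ltW c0)// rho_ge0.
- have Fle x y : x <= y -> F x <= F y.
    rewrite le_eqVlt => /predU1P[->//|/[dup] xy /mvt[z _ Fz]].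
    by rewrite -subr_ge0 Fz mulr_ge0 ?subr_ge0 ?(ltW xy)// rho_ge0.
  move=> x; rewrite /eta mulrC ler_pdivlMr// ler_pdivrMr// mul0r mul1r subr_ge0 lerD2r.
  have [x0|/ltW x0] := leP 0 x; last first.
    by rewrite (Fconst x 0) ?lexx ?Fle// => z; exact: rho_le0.
  have [x1|/ltW x1] := leP x 1; first by rewrite !Fle.
  by rewrite -(Fconst 1 x) ?lexx ?Fle// => z; exact: rho_ge1.
Qed.

End smooth_step.

(** * Weak derivatives on intervals *)

Section finite_integrals.
Context d (T : measurableType d) (R : realType) (mu : {measure set T -> \bar R}).

Lemma bounded_integrable (A : set T) (f : T -> R) (M : R) :
  measurable A -> (mu A < +oo)%E -> measurable_fun A f ->
  (forall x, A x -> `|f x| <= M) -> mu.-integrable A (EFin \o f).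
Proof.
move=> mA Aoo mf fM; apply: measurable_bounded_integrable => //.
exists M; split; first exact: num_real.
by move=> r Mr x Ax /=; rewrite (le_trans (fM x Ax))// ltW.
Qed.

(** On a set of finite measure 1 is integrable, and [|f| <= 1 + f ^+ 2]. *)
Lemma L2_integrable (A : set T) (f : T -> R) :
  measurable A -> (mu A < +oo)%E -> L2 mu A f -> mu.-integrable A (EFin \o f).
Proof.
move=> mA Aoo [mf f2].
have mf2 : measurable_fun A (fun x => f x ^+ 2) by exact: measurable_funX.
have if2 : mu.-integrable A (fun x => (f x ^+ 2)%:E).
  apply/integrableP; split; first exact/measurable_EFinP.
  by under eq_integral do rewrite gee0_abs ?lee_fin ?sqr_ge0//.
have i1 : mu.-integrable A (EFin \o cst (1 : R)).
  by apply: (@bounded_integrable _ _ 1) => // x _; rewrite normr1.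
apply: le_integrable (integrableD mA i1 if2) => //; first exact/measurable_EFinP.
move=> x _ /=; rewrite lee_fin [leRHS]ger0_norm ?addr_ge0 ?sqr_ge0//.
by rewrite -(real_normK (num_real (f x))); have := normr_ge0 (f x); nra.
Qed.

End finite_integrals.

Section interval_integrals.
Context (R : realType).
Local Notation mR := (measurableTypeR R).
Implicit Types (a x s t : R) (u v : R -> R).

(* The weight for which [\int oriented s t * v] is [\int_s^t v], whatever the order of
   [s] and [t]. *)
Definition oriented s t x : R := (s < x)%R%:R - (t < x)%R%:R.

Lemma measurable_section a : measurable (section a : set mR).
Proof. exact: measurable_itv. Qed.

Lemma section_lty a : (leb1 R (section a) < +oo)%E.
Proof. by rewrite /leb1 lebesgue_measure_itv/=; case: ifP; rewrite ?ltry. Qed.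

Lemma measurable_oriented s t : measurable_fun (setT : set mR) (oriented s t).
Proof.
have ind r : (fun x : R => (r < x)%R%:R : R) = \1_(`]r, +oo[%classic : set R).
  by apply/funext => x; rewrite indicE mem_setE in_itv/= andbT.
rewrite /oriented; apply: measurable_funB; rewrite ind; apply: measurable_indic;
  exact: measurable_itv.
Qed.

Lemma norm_oriented s t x :
  `|oriented s t x| = \1_(`]Num.min s t, Num.max s t]%classic : set R) x.
Proof.
rewrite indicE mem_setE in_itv/= gt_min le_max /oriented.
by case: (ltP s x); case: (ltP t x);
  rewrite ?subrr ?subr0 ?sub0r ?normrN ?normr1 ?normr0.
Qed.

Lemma Rintegral_oriented_le a s t (g : R -> R) (C : R) : section a s -> section a t ->
  measurable_fun (section a : set mR) g ->
  (forall x, Num.min s t < x <= Num.max s t -> `|g x| <= C) -> 0 <= C ->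
  (leb1 R).-integrable (section a) (EFin \o (fun x => g x * oriented s t x)) /\
  `|\int[leb1 R]_(x in section a) (g x * oriented s t x)| <= C * `|t - s|.
Proof.
move=> sa ta mg gC C0.
have gs x : `|g x * oriented s t x| <=
    C * \1_(`]Num.min s t, Num.max s t]%classic : set R) x.
  rewrite normrM norm_oriented indicE mem_setE in_itv/=.
  by have [/gC|_] := boolP (Num.min s t < x <= Num.max s t); rewrite ?mulr1 ?mulr0.
have mgs : measurable_fun (section a : set mR) (fun x => g x * oriented s t x).
  apply: measurable_funM => //.
  exact: measurable_funTS (measurable_oriented s t).
have mS := measurable_section a.
have mI : measurable (`]Num.min s t, Num.max s t]%classic : set mR) by exact: measurable_itv.
have igs : (leb1 R).-integrable (section a) (EFin \o (fun x => g x * oriented s t x)).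
  apply: (@bounded_integrable _ _ _ _ _ _ C) => //; first exact: section_lty.
  move=> x _; by rewrite (le_trans (gs x))// ler_piMr// indicE lern1 leq_b1.
split=> //.
apply: (le_trans (le_normr_Rintegral mS igs)).
have i1 : (leb1 R).-integrable (section a)
    (EFin \o (\1_(`]Num.min s t, Num.max s t]%classic : set R) : R -> R)).
  apply: (@bounded_integrable _ _ _ _ _ _ 1) => //; first exact: section_lty.
  by move=> x _; rewrite indicE; case: (x \in _); rewrite ?normr1 ?normr0.
apply: (@le_trans _ _ (\int[leb1 R]_(x in section a)
    (C * \1_(`]Num.min s t, Num.max s t]%classic : set R) x))).
  apply: le_Rintegral => //.
  - exact: integrable_norm.
  - by have := integrableZl mS C i1.
rewrite RintegralZl// ler_wpM2l// /Rintegral integral_indic//.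
rewrite setIidl; last first.
  move: sa ta; rewrite /section/= !in_itv/= => /andP[s1 s2] /andP[t1 t2] x/=.
  rewrite !in_itv/= => /andP[mx xM]; rewrite (le_lt_trans _ mx) ?(le_lt_trans xM)//.
    by rewrite gt_max s2.
  by rewrite le_min !ltW.
rewrite [X in fine X](_ : _ = lebesgue_measure (`]Num.min s t, Num.max s t]%classic : set R))//.
rewrite lebesgue_measure_itv/= lte_fin.
by case: (leP s t) => st; case: ifPn => _ /=; rewrite ?normr_ge0//;
  [rewrite ger0_norm ?subr_ge0|rewrite ler0_norm ?opprB// ltW// subr_lt0].
Qed.

Lemma derive_step_out (theta : R -> R) (lo hi x : R) :
  (forall x, x <= lo -> theta x = 0) -> (forall x, hi <= x -> theta x = 1) ->
  x \notin `[lo, hi] -> 'D_1 theta x = 0.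
Proof.
move=> t0 t1; rewrite in_itv/= negb_and -!ltNge => /orP[xl|xh].
- rewrite (_ : 0 = 'D_1 (cst (0 : R)) x); last by rewrite derive_cst.
  apply: near_eq_derive; near=> y; rewrite t0//.
  by apply: ltW; near: y; exact: lt_nbhsl.
- rewrite (_ : 0 = 'D_1 (cst (1 : R)) x); last by rewrite derive_cst.
  apply: near_eq_derive; near=> y; rewrite t1//.
  by apply: ltW; near: y; exact: lt_nbhsr.
Unshelve. all: by end_near. Qed.

(** The derivative [h] of a step is a non-negative kernel of mass [theta hi - theta lo = 1] carried
    by [[lo, hi]]. Integrating [u] against it is averaging [u] there, so the result stays as close
    to [l] as [u] does. *)
Lemma average_derive_step a (theta : R -> R) (lo hi : R) u (l eps : R) :
  let h := D1 tt theta in smooth theta -> (forall x, x <= lo -> theta x = 0) ->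
  (forall x, hi <= x -> theta x = 1) -> (forall x, 0 <= h x) ->
  - a < lo -> lo < hi -> hi < a -> measurable_fun (section a : set mR) u ->
  (forall x, x \in `[lo, hi] -> `|u x - l| <= eps) ->
  (leb1 R).-integrable (section a) (EFin \o (fun x => u x * h x)) /\
  `|\int[leb1 R]_(x in section a) (u x * h x) - l| <= eps.
Proof.
move=> h sth t0 t1 dth alo lohi hia mu_ ul.
have ch : continuous h by exact/smooth_continuous/smooth_derive.
have mI : measurable (`[lo, hi]%classic : set mR) by exact: measurable_itv.
have IS : `[lo, hi]%classic `<=` section a.
  move=> x /=; rewrite /section/= !in_itv/= => /andP[lx xh].
  by rewrite (lt_le_trans alo lx) (le_lt_trans xh hia).
have ih : (leb1 R).-integrable `[lo, hi] (EFin \o h).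
  apply: continuous_compact_integrable; first exact: segment_compact.
  exact: continuous_subspaceT.
have muI : measurable_fun (`[lo, hi]%classic : set mR) u by exact: measurable_funS (measurable_section a) IS mu_.
have iuh (g : R -> R) (M : R) : measurable_fun (`[lo, hi]%classic : set mR) g ->
    (forall x, x \in `[lo, hi] -> `|g x| <= M) ->
    (leb1 R).-integrable `[lo, hi] (EFin \o (fun x => g x * h x)).
  move=> mg gM.
  have bg : [bounded (g x : R^o) | x in (`[lo, hi]%classic : set R)].
    exists M; split; first exact: num_real.
    by move=> r Mr x Ix /=; rewrite (le_trans (gM x Ix))// ltW.
  have := integrableMl mI ih mg bg; apply: eq_integrable => // x _ /=.
  by rewrite mulrC.
have uhE : (fun x => u x * h x) = (fun x => u x * h x) \_ `[lo, hi].
  apply/funext => x; rewrite patchE; case: ifPn => //; rewrite mem_setE => xI.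
  by rewrite /h /D1 (derive_step_out t0 t1)// mulr0.
have i1 : (leb1 R).-integrable `[lo, hi] (EFin \o (fun x => u x * h x)).
  apply: (iuh _ (`|l| + eps)) => // x xI.
  rewrite -[u x](subrK l) addrC (le_trans (ler_normD _ _))// lerD2l.
  exact: ul.
split.
  rewrite uhE; have := (integrable_mkcond _ mI).1 i1.
  rewrite restrict_EFin => /integrableS; apply => //; exact: measurable_section.
rewrite uhE -Rintegral_mkcondr setIidr//.
have int1 : \int[leb1 R]_(x in `[lo, hi]) h x = 1.
  rewrite /Rintegral (@continuous_FTC2 _ h theta)//.
  - by rewrite -EFinB /= t1// t0// subr0.
  - exact: continuous_subspaceT.
  - split; first by move=> x _; exact: smooth_derivable.
      apply: cvg_at_right_filter; exact: smooth_continuous.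
    apply: cvg_at_left_filter; exact: smooth_continuous.
  - by move=> x _; rewrite derive1E.
have -> : l = \int[leb1 R]_(x in `[lo, hi]) (l * h x) by rewrite RintegralZl// int1 mulr1.
have il : (leb1 R).-integrable `[lo, hi] (EFin \o (fun x => l * h x)).
  by have := integrableZl mI l ih.
rewrite -RintegralB//.
have iB : (leb1 R).-integrable `[lo, hi] (EFin \o (fun x => u x * h x - l * h x)).
  have := iuh (fun x => u x - l) eps; rewrite (_ : (fun x => (u x - l) * h x) =
    (fun x => u x * h x - l * h x)); last by apply/funext => x; rewrite mulrBl.
  apply => //; apply: measurable_funB => //; exact: measurable_cst.
apply: (le_trans (le_normr_Rintegral mI iB)).
rewrite -[leRHS]mulr1 -int1 -RintegralZl//; apply: le_Rintegral => //.
- exact: integrable_norm.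
- by have := integrableZl mI eps ih.
- by move=> x Ix; rewrite -mulrBl normrM [`|h x|]ger0_norm ?dth// ler_wpM2r ?dth ?ul.
Qed.

(** The step rises between [r] and [r + d / (n + 1)] and vanishes at [r] itself, so the limit is the
    strict indicator that enters [oriented]. *)
Lemma cvg_smooth_step (eta : R -> R) (r d : R) : 0 < d ->
  (forall x, x <= 0 -> eta x = 0) -> (forall x, 1 <= x -> eta x = 1) ->
  forall x, eta ((d / n.+1%:R)^-1 * x + - ((d / n.+1%:R)^-1 * r)) @[n --> \oo]
    --> ((r < x)%R%:R : R).
Proof.
move=> d0 e0 e1 x; have dn0 n : 0 < (d / n.+1%:R)^-1 by rewrite invr_gt0 divr_gt0.
have [rx|xr] := ltP r x; last first.
  apply: cvg_near_cst; apply: nearW => n; rewrite e0// -mulrBr.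
  by rewrite pmulr_rle0// subr_le0.
have xd0 : 0 < (x - r) / d by rewrite divr_gt0// subr_gt0.
apply: cvg_near_cst; near=> n; rewrite e1// -mulrBr ler_pdivlMl ?divr_gt0// mulr1.
rewrite ltW// mulrC -ltr_pdivlMr//.
near: n; exact: (near_infty_natSinv_lt (PosNum xd0)).
Unshelve. all: by end_near. Qed.

(** The weak derivative is tested against the difference of two steps, one rising just after [s] and
    one just after [t]. As they sharpen, this difference tends to [oriented s t] while its
    derivative averages [u] near [s] minus [u] near [t]. *)
Lemma weak_derivative_integral a u v s t :
  measurable_fun (section a : set mR) u -> L2 (leb1 R) (section a) v ->
  weak_derivative (leb1 R) (section a) (test_function (section a)) (@D1 R) tt u v ->
  section a s -> section a t -> {for s, continuous u} -> {for t, continuous u} ->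
  u t - u s = \int[leb1 R]_(x in section a) (v x * oriented s t x).
Proof.
move=> mu_ v2 wd sa ta cs ct.
have mS := measurable_section a.
have [eta [seta e0 e1 deta etab]] := smooth_step R.
have sta : Num.max s t < a.
  by move: sa ta; rewrite /section/= !in_itv/= gt_max => /andP[_ ->] /andP[_ ->].
(* Both steps have reached 1 at [Num.max s t + d], still inside the section, so their difference has
   compact support there. *)
set d := (a - Num.max s t) / 2.
have d0 : 0 < d by rewrite divr_gt0// subr_gt0.
pose th r n x := eta ((d / n.+1%:R)^-1 * x + - ((d / n.+1%:R)^-1 * r)).
have en0 n : 0 < d / n.+1%:R by rewrite divr_gt0.
have end_ n : d / n.+1%:R <= d.
  by rewrite ler_pdivrMr// ler_peMr ?(ltW d0)// ler1n.
have sth r n : smooth (th r n) by exact: smooth_affine.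
have th0 r n x : x <= r -> th r n x = 0.
  by move=> xr; rewrite /th e0// -mulrBr pmulr_rle0 ?invr_gt0// subr_le0.
have th1 r n x : r + d / n.+1%:R <= x -> th r n x = 1.
  move=> xr; rewrite /th e1// -mulrBr -[leLHS](mulVf (lt0r_neq0 (en0 n))).
  by rewrite ler_pM2l ?invr_gt0// lerBrDl.
have dth r n x : 0 <= D1 tt (th r n) x.
  have := is_derive_affine (smooth_is_derive
    ((d / n.+1%:R)^-1 * x + - ((d / n.+1%:R)^-1 * r)) seta) => H.
  by rewrite /D1 derive_val mulr_ge0// invr_ge0 ltW.
have test n : test_function (section a) (th s n \- th t n).
  split; first exact: smoothB.
  exists (`[Num.min s t, Num.max s t + d / n.+1%:R]%classic); split.
  - exact: segment_compact.
  - move=> x; rewrite /section/= !in_itv/= => /andP[lx xh]; apply/andP; split.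
      apply: lt_le_trans lx; rewrite lt_min.
      by move: sa ta; rewrite /section/= !in_itv/= => /andP[-> _] /andP[-> _].
    apply: (le_lt_trans xh); rewrite -ltrBrDl (le_lt_trans (end_ n))// /d.
    by rewrite ltr_pdivrMr// ltr_pMr ?subr_gt0// ltr1n.
  - move=> x /= /negP; rewrite in_itv/= negb_and -!ltNge => /orP[xl|xh].
      by move: xl; rewrite lt_min => /andP[/ltW xs /ltW xt]; rewrite !th0// subrr.
    rewrite !th1 ?subrr// ltW// (le_lt_trans _ xh)// lerD2r le_max lexx ?orbT//.
have avg (r eps : R) : section a r -> r + d < a -> {for r, continuous u} -> 0 < eps ->
    \forall n \near \oo, (leb1 R).-integrable (section a)
       (EFin \o (fun x => u x * D1 tt (th r n) x)) /\
    `|\int[leb1 R]_(x in section a) (u x * D1 tt (th r n) x) - u r| <= eps.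
  move=> ra rda cr eps0.
  have /cvgr_dist_le/(_ eps eps0)/nbhs_ballP[del /= del0 hdel] := cr.
  have deld0 : 0 < del / d by rewrite divr_gt0.
  near=> n; have dn : d / n.+1%:R < del.
    rewrite mulrC -ltr_pdivlMr//; near: n.
    exact: (near_infty_natSinv_lt (PosNum deld0)).
  apply: (@average_derive_step _ _ r (r + d / n.+1%:R)) => //.
  - by move=> x; exact: th0.
  - by move=> x; exact: th1.
  - by move: ra; rewrite /section/= in_itv/= => /andP[].
  - by rewrite ltrDl.
  - by apply: le_lt_trans rda; rewrite lerD2l.
  - move=> x; rewrite in_itv/= => /andP[rx xr]; rewrite distrC; apply: hdel.
    rewrite /ball/= distrC ger0_norm ?subr_ge0//.
    by apply: le_lt_trans dn; rewrite lerBlDl.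
have sda r : r <= Num.max s t -> r + d < a.
  move=> rm; rewrite /d; lra.
have avgs := avg s _ sa (sda s _) cs.
have avgt := avg t _ ta (sda t _) ct.
have cvu : \int[leb1 R]_(x in section a) (u x * D1 tt (th s n \- th t n) x) @[n --> \oo]
    --> u s - u t.
  apply/cvgrPdist_le => eps eps0; have eps20 : 0 < eps / 2 by rewrite divr_gt0.
  near=> n.
  have [is_ hs] : (leb1 R).-integrable (section a)
       (EFin \o (fun x => u x * D1 tt (th s n) x)) /\
    `|\int[leb1 R]_(x in section a) (u x * D1 tt (th s n) x) - u s| <= eps / 2.
    by near: n; apply: avgs; rewrite // le_max lexx.
  have [it_ ht] : (leb1 R).-integrable (section a)
       (EFin \o (fun x => u x * D1 tt (th t n) x)) /\
    `|\int[leb1 R]_(x in section a) (u x * D1 tt (th t n) x) - u t| <= eps / 2.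
    by near: n; apply: avgt; rewrite // le_max lexx orbT.
  have -> : \int[leb1 R]_(x in section a) (u x * D1 tt (th s n \- th t n) x) =
     \int[leb1 R]_(x in section a) (u x * D1 tt (th s n) x) -
     \int[leb1 R]_(x in section a) (u x * D1 tt (th t n) x).
    rewrite -RintegralB//; apply: eq_Rintegral => x _; rewrite -mulrBr; congr (_ * _).
    by apply: (@deriveB _ _ _ (th s n) (th t n)); exact: smooth_derivable.
  move: hs ht; move: (\int[_]_(_ in _) _) => A; move: (\int[_]_(_ in _) _) => B.
  rewrite !ler_norml => /andP[? ?] /andP[? ?]; apply/andP; split; lra.
have iv : (leb1 R).-integrable (section a) (EFin \o v).
  by apply: L2_integrable => //; exact: section_lty.
have mv : measurable_fun (section a : set mR) v by case: v2.
have cvv : \int[leb1 R]_(x in section a) (v x * (th s n x - th t n x)) @[n --> \oo]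
   --> \int[leb1 R]_(x in section a) (v x * oriented s t x).
  have mth r n : measurable_fun (section a : set mR) (th r n).
    by apply: measurable_funTS; apply: continuous_measurable_fun; exact: smooth_continuous.
  have [| | | | |ig _ cvI] := @dominated_convergence _ _ _ (leb1 R) (section a) mS
    (fun n x => (v x * (th s n x - th t n x))%:E) (fun x => (v x * oriented s t x)%:E)
    (fun x => `|(v x)%:E|%E).
  - move=> n; apply/measurable_EFinP/measurable_funM => //.
    exact: measurable_funB.
  - apply/measurable_EFinP/measurable_funM => //.
    by apply: measurable_funTS; exact: measurable_oriented.
  - apply: aeW => x _; apply: cvg_EFin; first exact: nearW.
    apply: cvgM; first exact: cvg_cst.
    by apply: cvgB; exact: cvg_smooth_step.
  - exact: integrable_abse.
  - apply: aeW => x n _ /=; rewrite lee_fin normrM ler_piMr//.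
    have /andP[? ?] := etab ((d / n.+1%:R)^-1 * x + - ((d / n.+1%:R)^-1 * s)).
    have /andP[? ?] := etab ((d / n.+1%:R)^-1 * x + - ((d / n.+1%:R)^-1 * t)).
    rewrite ler_norml /th; apply/andP; split; lra.
  apply: fine_cvg; rewrite fineK; first exact: cvI.
  exact: integrable_fin_num.
have : \int[leb1 R]_(x in section a) (u x * D1 tt (th s n \- th t n) x) @[n --> \oo]
    --> - \int[leb1 R]_(x in section a) (v x * oriented s t x).
  rewrite (_ : (fun n => _) = (fun n =>
    - \int[leb1 R]_(x in section a) (v x * (th s n x - th t n x)))); first exact: cvgN.
  apply/funext => n; rewrite /Rintegral -fineN; congr fine.
  by have := wd _ (test n).
move/(cvg_unique (@Rhausdorff R) cvu) => /eqP.
by rewrite -eqr_oppLR opprB => /eqP.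
Unshelve. all: by end_near. Qed.

End interval_integrals.

(** * Bounds and measurability for the Jacobi equation *)

Section primitive.
Context (R : realType).
Local Notation mR := (measurableTypeR R).
Implicit Types (a x s t : R) (g : R -> R).

Definition prim a g t : R := \int[leb1 R]_(x in section a) (g x * oriented 0 t x).

Lemma section0 a : 0 < a -> section a 0.
Proof. by move=> a0; rewrite /section/= in_itv/= oppr_lt0 a0. Qed.

Lemma section_norm a t : section a t <-> `|t| < a.
Proof. by rewrite /section/= in_itv/= ltr_norml. Qed.

Lemma prim_le a g (C : R) t : section a t -> measurable_fun (section a : set mR) g ->
  (forall x, `|x| <= `|t| -> `|g x| <= C) -> 0 <= C ->
  (leb1 R).-integrable (section a) (EFin \o (fun x => g x * oriented 0 t x)) /\
  `|prim a g t| <= C * `|t|.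
Proof.
move=> ta mg gC C0; rewrite -[in leRHS](subr0 t); apply: Rintegral_oriented_le => //.
  apply: section0; have /section_norm := ta; exact: le_lt_trans.
move=> x xt; apply: gC; move: xt; case: (leP 0 t) => t0 /andP[x0 xt].
  by rewrite !ger0_norm// ltW.
by rewrite !ler0_norm ?lerN2 ?(ltW t0)// ltW.
Qed.

Lemma primB a g1 g2 (C : R) t : section a t ->
  measurable_fun (section a : set mR) g1 -> measurable_fun (section a : set mR) g2 ->
  (forall x, `|x| <= `|t| -> `|g1 x| <= C) -> (forall x, `|x| <= `|t| -> `|g2 x| <= C) ->
  0 <= C -> prim a (fun x => g1 x - g2 x) t = prim a g1 t - prim a g2 t.
Proof.
move=> ta m1 m2 b1 b2 C0; rewrite /prim -RintegralB//.
- by apply: eq_Rintegral => x _; rewrite mulrBl.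
- exact: measurable_section.
- exact: (prim_le ta m1 b1 C0).1.
- exact: (prim_le ta m2 b2 C0).1.
Qed.

(** The Sobolev formulation becomes a system of two integral equations for [y] and [p = y']. The
    second derivative equals [- k y] only almost everywhere, which is enough under the integral
    sign. *)
Lemma jacobi_integral a (k y : R -> R) : 0 < a ->
  measurable_fun (section a : set mR) k -> jacobi_solution a k y ->
  exists p : R -> R,
   [/\ measurable_fun (section a : set mR) y /\ measurable_fun (section a : set mR) p,
     forall t, section a t -> {for t, continuous y} /\ {for t, continuous p},
     forall s t, section a s -> section a t ->
       y t - y s = \int[leb1 R]_(x in section a) (p x * oriented s t x),
     forall t, section a t -> y t = 1 + prim a p t &
     forall t, section a t -> p t = prim a (fun x => - (k x * y x)) t].
Proof.
move=> a0 mk [p [q [[y2 p2 wyp] [p2' q2 wpq] cyp [y0 p0] qky]]].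
have my : measurable_fun (section a : set mR) y by case: y2.
have mp : measurable_fun (section a : set mR) p by case: p2'.
have mq : measurable_fun (section a : set mR) q by case: (q2 tt).
have yst s t : section a s -> section a t ->
    y t - y s = \int[leb1 R]_(x in section a) (p x * oriented s t x).
  move=> sa ta; apply: weak_derivative_integral => //.
  - exact: (cyp s sa).1.
  - exact: (cyp t ta).1.
have sa0 := section0 a0.
exists p; split => //.
- by move=> t ta; rewrite /prim -yst// y0 addrC subrK.
- move=> t ta; have -> : p t = p t - p 0 by rewrite p0 subr0.
  rewrite (@weak_derivative_integral _ a p q)//.
  + rewrite /prim /Rintegral; congr fine; apply: ae_eq_integral.
    * exact: measurable_section.
    * apply/measurable_EFinP/measurable_funM => //.
      exact: measurable_funTS (measurable_oriented _ _).
    * apply/measurable_EFinP/measurable_funM => //.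
        exact/measurable_funN/measurable_funM.
      exact: measurable_funTS (measurable_oriented _ _).
    * apply: (@filterS _ _ (ae_filter_ringOfSetsType (leb1 R)) _ _ _ qky).
      by move=> x qx /qx /eqP; rewrite addr_eq0 => /eqP ->.
  + exact: q2 tt.
  + exact: (cyp 0 sa0).2.
  + exact: (cyp t ta).2.
Qed.

(** With [S] the maximum of [|y|] on [[-|t|, |t|]], the integral equations give [|p| <= kappa S a]
    and then [|y - 1| <= th S]. So [S <= 1 + th S], and [S] is absorbed because [th < 1]. The
    compact subinterval makes [S] finite: continuity of [y] is known only inside the open section.
    The Lipschitz constant is the resulting bound on [|p|]. *)
Lemma jacobi_bound a (k y : R -> R) (kappa : R) : 0 < a ->
  measurable_fun (section a : set mR) k ->
  (forall t, section a t -> `|k t| <= kappa) -> kappa * a ^+ 2 < 1 ->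
  jacobi_solution a k y ->
  let th := kappa * a ^+ 2 in
  (forall t, section a t -> `|y t - 1| <= th / (1 - th)) /\
  (forall s t, section a s -> section a t ->
     `|y t - y s| <= kappa * a / (1 - th) * `|t - s|).
Proof.
move=> a0 mk kk th1 jac th.
have [p [[my mp] cyp yst yE pE]] := jacobi_integral a0 mk jac.
have sa0 := section0 a0.
have kappa0 : 0 <= kappa by exact: le_trans (kk 0 sa0).
have th0 : 0 <= th by rewrite mulr_ge0// sqr_ge0.
have inS t x : section a t -> `|x| <= `|t| -> section a x.
  by move=> /section_norm ta xt; apply/section_norm; exact: le_lt_trans ta.
have na t : section a t -> `|t| <= a by move=> /section_norm /ltW.
have mky : measurable_fun (section a : set mR) (fun x => - (k x * y x)).
  exact/measurable_funN/measurable_funM.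
(* [S] is the maximum of [|y|] on [[-|t|, |t|]] *)
have key t : section a t -> exists2 S, [/\ 0 <= S, S <= 1 / (1 - th) & `|p t| <= kappa * S * a] &
    `|y t| <= S /\ `|y t - 1| <= th * S.
  move=> ta.
  have [] := @EVT_max R (fun x => `|y x|) (- `|t|) `|t|.
  - by rewrite -subr_ge0 opprK addr_ge0.
  - apply: continuous_in_subspaceT => x; rewrite inE/= in_itv/= -ler_norml => xt.
    by apply: continuous_comp; [exact: (cyp x (inS _ _ ta xt)).1|exact: norm_continuous].
  move=> c; rewrite in_itv/= -ler_norml => ct hc; pose S : R := `|y c|.
  have {}hc x : `|x| <= `|t| -> `|y x| <= S.
    by move=> xt; apply: hc; rewrite in_itv/= -ler_norml.
  have S0 : 0 <= S by exact: normr_ge0.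
  have pS x : `|x| <= `|t| -> `|p x| <= kappa * S * a.
    move=> xt; have xa := inS _ _ ta xt; rewrite pE//.
    have [|_] := @prim_le a (fun x => - (k x * y x)) (kappa * S) x xa mky _ (mulr_ge0 kappa0 S0).
      move=> z zx; rewrite normrN normrM ler_pM//.
        by apply: kk; exact: inS zx.
      by apply: hc; exact: le_trans xt.
    by move/le_trans; apply; rewrite ler_wpM2l ?na// mulr_ge0.
  have kSa : 0 <= kappa * S * a by rewrite !mulr_ge0// ltW.
  have yS x : `|x| <= `|t| -> `|y x - 1| <= th * S.
    move=> xt; have xa := inS _ _ ta xt; rewrite yE// addrAC subrr add0r.
    have [|_] := @prim_le a p (kappa * S * a) x xa mp _ kSa.
      by move=> z zx; apply: pS; exact: le_trans xt.
    move/le_trans; apply; rewrite (_ : th * S = kappa * S * a * a); last by rewrite /th; ring.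
    by rewrite ler_wpM2l ?na.
  exists S; last by split; [exact: hc|exact: yS].
  split => //; last exact: pS.
  rewrite ler_pdivlMr ?subr_gt0// mulrBr mulr1 lerBlDr.
  have : `|y c| <= `|y c - 1| + `|1 : R| by rewrite -[in leLHS](subrK 1 (y c)) ler_normD.
  rewrite normr1 -/S => /le_trans; apply; rewrite addrC lerD2l mulrC.
  exact: yS.
split.
- move=> t ta; have [S [S0 S1 _] [_ h]] := key t ta.
  by rewrite (le_trans h)// ler_wpM2l// (le_trans S1)// div1r.
- move=> s t sa ta; rewrite yst//; apply: (Rintegral_oriented_le sa ta mp _ _).2.
    move=> x xst; have xa : section a x.
      move: sa ta xst; rewrite /section/= !in_itv/= => /andP[s1 s2] /andP[t1 t2].
      by case: (leP s t) => _ /andP[h1 h2]; apply/andP; split; lra.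
    have [S [S0 S1 h] _] := key x xa.
    rewrite (le_trans h)// [leRHS]mulrAC ler_wpM2r ?(ltW a0)// ler_wpM2l//.
    by rewrite -div1r.
  by rewrite mulr_ge0 ?mulr_ge0 ?(ltW a0)// invr_ge0 subr_ge0 ltW.
Qed.

End primitive.

Section picard.
Context (R : realType).
Local Notation mR := (measurableTypeR R).
Local Notation T2 := (mR * mR)%type.
Implicit Types (a x s t : R).

Lemma measurable_strip a : measurable (strip a : set T2).
Proof.
rewrite (_ : strip a = [set: mR] `*` (section a : set mR)).
  by apply: measurableX => //; exact: measurable_section.
by apply/seteqP; split => z /=; rewrite /section/= in_itv/=; [split|case].
Qed.

Definition prim2 a (g : R * R -> R) (z : R * R) : R := prim a (fun s => g (z.1, s)) z.2.

(** The weight [oriented] turns the moving endpoint [z.2] into a variable of the integrand. The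
    integrand is then measurable in three variables, and Tonelli's theorem applies to its positive
    and negative parts. *)
Lemma measurable_prim2 a (g : R * R -> R) : measurable_fun (setT : set T2) g ->
  measurable_fun (setT : set T2) (prim2 a g).
Proof.
move=> mg.
pose F (w : T2 * mR) : \bar R :=
  (g (w.1.1, w.2) * oriented 0 w.1.2 w.2 * \1_(section a : set mR) w.2)%:E.
have mlt (h1 h2 : T2 * mR -> R) : measurable_fun setT h1 -> measurable_fun setT h2 ->
    measurable_fun setT (fun w => (h1 w < h2 w)%R%:R : R).
  move=> m1 m2; rewrite (_ : (fun w => _) = fun w => if h1 w < h2 w then 1 else 0).
    by apply: measurable_fun_ifT => //; exact: measurable_fun_ltr.
  by apply/funext => w; case: (h1 w < h2 w).
have m12 : measurable_fun setT (fun w : T2 * mR => w.1.2 : R).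
  exact: (measurableT_comp measurable_snd measurable_fst).
have m11 : measurable_fun setT (fun w : T2 * mR => w.1.1 : mR).
  exact: (measurableT_comp measurable_fst measurable_fst).
have m2 : measurable_fun setT (fun w : T2 * mR => w.2 : mR) by exact: measurable_snd.
have mF : measurable_fun setT F.
  apply/measurable_EFinP; apply: measurable_funM; first apply: measurable_funM.
  - apply: (measurableT_comp mg); exact: measurable_fun_pair.
  - apply: measurable_funB; exact: mlt.
  - apply: (measurableT_comp _ m2); apply: measurable_indic.
    exact: measurable_section.
have -> : prim2 a g = (fun z => fine (fubini_F (leb1 R) F^\+%E z - fubini_F (leb1 R) F^\-%E z)%E).
  apply/funext => z; rewrite /prim2 /prim /Rintegral integral_mkcond.
  rewrite (_ : _ \_ _ = fun s => F (z, s)); last first.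
    apply/funext => s; rewrite patchE /F /= indicE.
    by case: ifP => _ /=; rewrite ?mulr1 ?mulr0.
  by rewrite integralE; congr (fine (_ - _)%E); apply: eq_integral => s _;
    rewrite ?funeposE ?funenegE.
apply: (measurableT_comp (@fine_measurable R setT measurableT)).
apply: emeasurable_funB; apply: measurable_fun_fubini_tonelli_F.
- exact: measurable_funepos.
- by move=> w; exact: funepos_ge0.
- exact: measurable_funeneg.
- by move=> w; exact: funeneg_ge0.
Qed.

Fixpoint picard a (K : R * R -> R) n : R * R -> R :=
  if n is n.+1 then
    fun z => 1 + prim2 a (prim2 a (fun w => - (K w * picard a K n w))) z
  else cst 1.

Lemma measurable_picard a (K : R * R -> R) n : measurable_fun (setT : set T2) K ->
  measurable_fun (setT : set T2) (picard a K n).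
Proof.
move=> mK; elim: n => [|n ih] /=; first exact: measurable_cst.
apply: measurable_funD; first exact: measurable_cst.
by do 2 apply: measurable_prim2; apply: measurable_funN; exact: measurable_funM.
Qed.

(** One Picard step multiplies the error by [K] and integrates twice, each integration costing a
    factor [a]; the error thus shrinks by [th = kappa a^2]. The initial error [|1 - f|] is bounded
    by [jacobi_bound]. *)
Lemma picard_le a (K f : R * R -> R) (kappa : R) : 0 < a ->
  measurable_fun (setT : set T2) K ->
  (forall z, strip a z -> `|K z| <= kappa) -> kappa * a ^+ 2 < 1 ->
  (forall x, jacobi_solution a (fun t => K (x, t)) (fun t => f (x, t))) ->
  let th := kappa * a ^+ 2 in forall n z, strip a z ->
  `|picard a K n z - f z| <= th / (1 - th) * th ^+ n.
Proof.
move=> a0 mK Kk th1 jac th.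
have mslice (g : R * R -> R) x : measurable_fun (setT : set T2) g ->
    measurable_fun (section a : set mR) (fun t => g (x, t)).
  by move=> mg; apply: measurable_funTS; exact: (measurable_fun_pair2 x mg).
have Kx x t : section a t -> `|K (x, t)| <= kappa.
  by move=> ta; apply: Kk; move: ta; rewrite /section/strip/= in_itv.
have kappa0 : 0 <= kappa by exact: le_trans (Kx 0 0 (section0 a0)).
have th0 : 0 <= th by rewrite mulr_ge0// sqr_ge0.
set C := th / (1 - th).
have C0 : 0 <= C by rewrite divr_ge0// subr_ge0 ltW.
have fb x t : section a t -> `|f (x, t) - 1| <= C.
  by move=> ta; have [/(_ t ta)] := jacobi_bound a0 (mslice _ x mK) (Kx x) th1 (jac x).
clearbody C.
have inS t x : section a t -> `|x| <= `|t| -> section a x.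
  by move=> /section_norm ta xt; apply/section_norm; exact: le_lt_trans ta.
have na t : section a t -> `|t| <= a by move=> /section_norm /ltW.
elim=> [|n ih] [x t] xt; have ta : section a t by move: xt; rewrite /section/strip/= in_itv.
  by rewrite expr0 mulr1 distrC fb.
have [p [[my mp] _ _ yE pE]] := jacobi_integral a0 (mslice _ x mK) (jac x).
rewrite /= yE// opprD addrACA subrr add0r.
set Y := picard a K n in ih *.
have mY := @measurable_picard a K n mK.
have thn0 : 0 <= th ^+ n by exact: exprn_ge0.
have Yf s : section a s -> `|Y (x, s) - f (x, s)| <= C * th ^+ n.
  by move=> sa; apply: ih; move: sa; rewrite /section/strip/= in_itv.
(* Crude bounds, uniform in [n]: they make the integrals finite, so that [primB] may combine two of
   them into the integral of a difference. *)
have fb1 s : section a s -> `|f (x, s)| <= 1 + C.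
  move=> sa; rewrite -[f _](subrK 1) addrC (le_trans (ler_normD _ _))//.
  by rewrite normr1 lerD2l fb.
have thn1 : th ^+ n <= 1 by rewrite exprn_ile1// ltW.
have Yb s : section a s -> `|Y (x, s)| <= 1 + C + C.
  move=> sa; rewrite -[Y _](subrK (f (x, s))) addrC (le_trans (ler_normD _ _))//.
  rewrite lerD ?fb1// (le_trans (Yf s sa))// ler_piMr//.
set A := prim a (fun s => - (K (x, s) * Y (x, s))).
have AE : prim2 a (fun w => - (K w * Y w)) = (fun z => prim a (fun s => - (K (z.1, s) * Y (z.1, s))) z.2) by [].
have mKY : measurable_fun (section a : set mR) (fun s => - (K (x, s) * Y (x, s))).
  by apply: measurable_funN; apply: measurable_funM; exact: mslice.
have mKf : measurable_fun (section a : set mR) (fun s => - (K (x, s) * f (x, s))).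
  by apply: measurable_funN; apply: measurable_funM => //; exact: mslice.
have bKY s : section a s -> `|- (K (x, s) * Y (x, s))| <= kappa * (1 + C + C).
  by move=> sa; rewrite normrN normrM ler_pM ?Kx ?Yb.
have bKf s : section a s -> `|- (K (x, s) * f (x, s))| <= kappa * (1 + C + C).
  move=> sa; rewrite normrN normrM ler_pM ?Kx// (le_trans (fb1 _ sa))//.
  by rewrite lerDl.
have B0 : 0 <= kappa * (1 + C + C) by rewrite mulr_ge0// !addr_ge0.
have Ap s : section a s -> `|A s - p s| <= kappa * (C * th ^+ n) * a.
  move=> sa; rewrite pE// /A -(@primB _ a _ _ (kappa * (1 + C + C)))//; first last.
  - by move=> r rs; apply: bKf; exact: inS rs.
  - by move=> r rs; apply: bKY; exact: inS rs.
  have [||_] := @prim_le _ a (fun s => - (K (x, s) * Y (x, s)) - - (K (x, s) * f (x, s)))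
    (kappa * (C * th ^+ n)) s sa (measurable_funB mKY mKf).
  - move=> r rs; have ra := inS _ _ sa rs.
    by rewrite -opprD normrN -mulrBr normrM ler_pM ?Kx ?Yf.
  - by rewrite !mulr_ge0.
  - by move/le_trans; apply; rewrite ler_wpM2l ?na// !mulr_ge0.
have mA : measurable_fun (section a : set mR) A.
  have := @measurable_prim2 a (fun w => - (K w * Y w)) => /(_ _)/mslice; apply.
  by apply: measurable_funN; exact: measurable_funM.
have bA s : section a s -> `|A s| <= kappa * (1 + C + C) * a.
  move=> sa; have [|_] := prim_le sa mKY _ B0.
    by move=> r rs; apply: bKY; exact: inS rs.
  by move/le_trans; apply; rewrite ler_wpM2l ?na.
have bp s : section a s -> `|p s| <= kappa * (1 + C + C) * a.
  move=> sa; rewrite pE//; have [|_] := prim_le sa mKf _ B0.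
    by move=> r rs; apply: bKf; exact: inS rs.
  by move/le_trans; apply; rewrite ler_wpM2l ?na.
have Ba0 : 0 <= kappa * (1 + C + C) * a by rewrite mulr_ge0// ltW.
rewrite -/(A) -(@primB _ a A p _ t ta mA mp _ _ Ba0); first last.
- by move=> r rs; apply: bp; exact: inS rs.
- by move=> r rs; apply: bA; exact: inS rs.
have [||_] := @prim_le _ a (fun s => A s - p s)
  (kappa * (C * th ^+ n) * a) t ta (measurable_funB mA mp).
- by move=> r rs; apply: Ap; exact: inS rs.
- by rewrite !mulr_ge0// ltW.
- move/le_trans; apply; rewrite exprS.
  rewrite (_ : C * (th * th ^+ n) = kappa * (C * th ^+ n) * a * a); last by rewrite {1}/th; ring.
  by rewrite ler_wpM2l ?na// !mulr_ge0// ltW.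
Qed.

(** Only the Picard iterates connect different slices: they are jointly measurable by construction
    and converge to [f] on the strip. [K] is extended by 0 so that they live on the whole plane;
    inside the strip the equation is unchanged. *)
Lemma measurable_jacobi a (K f : R * R -> R) (kappa : R) : 0 < a ->
  measurable_fun (strip a : set T2) K ->
  (forall z, strip a z -> `|K z| <= kappa) -> kappa * a ^+ 2 < 1 ->
  (forall x, jacobi_solution a (fun t => K (x, t)) (fun t => f (x, t))) ->
  measurable_fun (strip a : set T2) f.
Proof.
move=> a0 mK Kk th1 jac; pose K0 := K \_ (strip a).
have KE z : strip a z -> K0 z = K z by move=> za; rewrite /K0 patchE mem_set.
have mK0 : measurable_fun (setT : set T2) K0.
  exact: ((measurable_restrictT K (measurable_strip a)).1 mK).
have th0 : 0 <= kappa * a ^+ 2.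
  rewrite mulr_ge0 ?sqr_ge0// (le_trans (normr_ge0 _) (Kk (0, 0) _))//.
  by rewrite /strip/= oppr_lt0 a0.
apply: (@measurable_fun_cvg _ _ _ (strip a : set T2) (picard a K0)).
  by move=> n; apply: measurable_funTS; exact: measurable_picard.
move=> z za; apply/cvgrPdist_le => eps eps0.
set C := kappa * a ^+ 2 / (1 - kappa * a ^+ 2).
have gC : C * (kappa * a ^+ 2) ^+ n @[n --> \oo] --> (0 : R).
  have cth : (kappa * a ^+ 2) ^+ n @[n --> \oo] --> (0 : R).
    by apply: cvg_expr; rewrite ger0_norm.
  rewrite -[0](mulr0 C).
  exact: (@cvgM _ _ _ _ (fun=> C) (fun n => (kappa * a ^+ 2) ^+ n) _ _ (cvg_cst C) cth).
near=> n.
have hn : `|C * (kappa * a ^+ 2) ^+ n| <= eps.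
  rewrite -normrN -sub0r; near: n; exact: (cvgr_dist_le _ _ gC eps eps0).
rewrite distrC; apply: le_trans (le_trans (ler_norm _) hn).
apply: (@picard_le _ K0) => //; first by move=> w wa; rewrite KE// Kk.
move=> x; have [p [q [h1 h2 h3 h4 h5]]] := jac x; exists p, q; split=> //.
apply: (@filterS _ _ (ae_filter_ringOfSetsType (leb1 R)) _ _ _ h5) => t h ta.
by rewrite KE ?h//; move: ta; rewrite /section/strip/= in_itv.
Unshelve. all: by end_near. Qed.

End picard.

(** * Slices of test functions and measurability of the transversal eigenvalue *)

Section slices.
Context (R : realType).
Local Notation mR := (measurableTypeR R).
Implicit Types (phi : R * R -> R).

Let quotient2 phi (x t v : R) :
  (fun h : R => h^-1 *: (((fun s => phi (x, s)) \o shift t) (h *: v) - phi (x, t))) =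
  (fun h : R => h^-1 *: ((phi \o shift (x, t)) (h *: ((0 : R), v)) - phi (x, t))).
Proof.
apply/funext => h; congr (_ *: (phi _ - _)).
by rewrite /= /shift/= -[(h *: v + t)]/((h *: ((0:R), v) + (x, t)).2)
  -[x in LHS]add0r -[0 in LHS](scaler0 _ h).
Qed.

Let quotient1 phi (x t v : R) :
  (fun h : R => h^-1 *: (((fun s => phi (s, t)) \o shift x) (h *: v) - phi (x, t))) =
  (fun h : R => h^-1 *: ((phi \o shift (x, t)) (h *: (v, (0 : R))) - phi (x, t))).
Proof.
apply/funext => h; congr (_ *: (phi _ - _)).
by rewrite /= /shift/= -[(h *: v + x)]/((h *: (v, (0:R)) + (x, t)).1)
  -[t in LHS]add0r -[0 in LHS](scaler0 _ h).
Qed.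

Lemma derive_slice2 phi (x t v : R) :
  'D_v (fun s => phi (x, s)) t = 'D_(0, v) phi (x, t).
Proof. by rewrite /derive quotient2. Qed.

Lemma derive_slice1 phi (x t v : R) :
  'D_v (fun s => phi (s, t)) x = 'D_(v, 0) phi (x, t).
Proof. by rewrite /derive quotient1. Qed.

Lemma smooth_slice2 phi (x : R) : smooth phi -> smooth (fun t => phi (x, t)).
Proof.
move=> sphi; apply: (@smooth_coind _ _ [set k | exists2 phi : R * R -> R, smooth phi &
  k = fun t => phi (x, t)]); last by exists phi.
move=> _ [chi schi ->]; split.
- move=> t; apply: (@continuous_comp _ _ _ (fun t => (x, t)) chi).
    by rewrite /prop_for /continuous_at; exact: (cvg_pair (cvg_cst x) cvg_id).
  exact: smooth_continuous.
- by move=> t v; rewrite /derivable quotient2; exact: smooth_derivable.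
- move=> v; exists (fun z => 'D_((0 : R), v) chi z); first exact: smooth_derive.
  by apply/funext => t; rewrite derive_slice2.
Qed.

Lemma smooth_slice1 phi (t : R) : smooth phi -> smooth (fun x => phi (x, t)).
Proof.
move=> sphi; apply: (@smooth_coind _ _ [set k | exists2 phi : R * R -> R, smooth phi &
  k = fun x => phi (x, t)]); last by exists phi.
move=> _ [chi schi ->]; split.
- move=> x; apply: (@continuous_comp _ _ _ (fun x => (x, t)) chi).
    by rewrite /prop_for /continuous_at; exact: (cvg_pair cvg_id (cvg_cst t)).
  exact: smooth_continuous.
- by move=> x v; rewrite /derivable quotient1; exact: smooth_derivable.
- move=> v; exists (fun z => 'D_(v, (0 : R)) chi z); first exact: smooth_derive.
  by apply/funext => x; rewrite derive_slice1.
Qed.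

Lemma test_slice2 a phi (x : R) : test_function (strip a) phi ->
  test_function (section a) (fun t => phi (x, t)).
Proof.
move=> [sphi [A [cA As phi0]]]; split; first exact: smooth_slice2.
exists (snd @` A); split.
- apply: continuous_compact cA; apply: continuous_subspaceT => z.
  exact: cvg_snd.
- by move=> _ [z /As + <-]; rewrite /strip/section/= in_itv.
- by move=> t At; apply: phi0; apply: contra_not At => At; exists (x, t).
Qed.

Lemma compact_slice1 a phi : test_function (strip a) phi ->
  exists2 N : R, 0 < N & forall x t, N <= `|x| -> phi (x, t) = 0.
Proof.
move=> [sphi [A [cA As phi0]]].
have /compact_bounded : compact (fst @` A).
  by apply: continuous_compact cA; apply: continuous_subspaceT => z; exact: cvg_fst.
move=> [M [_ hM]]; exists (`|M| + 2) => [|x t Nx].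
  by rewrite ltr_wpDl.
apply: phi0 => Axt; have : M < `|M| + 1 by rewrite (le_lt_trans (ler_norm M))// ltrDl.
move=> /hM/(_ x); have Ax : (fst @` A) x by exists (x, t).
move=> /(_ Ax) /=; apply/negP; rewrite -ltNge; apply: lt_le_trans Nx.
by rewrite ltrD2l ltr1n.
Qed.

End slices.

Section test_functions_section.
Context (R : realType).
Local Notation mR := (measurableTypeR R).
Implicit Types (w chi : R -> R).

Lemma continuous_L2 a w : 0 < a -> continuous w -> L2 (leb1 R) (section a) w.
Proof.
move=> a0 cw.
have mw : measurable_fun (section a : set mR) w.
  by apply: measurable_funTS; exact: continuous_measurable_fun.
split=> //.
have cw2 : continuous (fun x => w x ^+ 2).
  by move=> x; exact: (continuous_comp (cw x) (@exprn_continuous R 2 (w x))).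
have : (leb1 R).-integrable (section a) (EFin \o (fun x => w x ^+ 2)).
  have : (leb1 R).-integrable `[- a, a] (EFin \o (fun x => w x ^+ 2)).
    apply: continuous_compact_integrable; first exact: segment_compact.
    exact: continuous_subspaceT.
  move/integrableS; apply => //; first exact: measurable_section.
  exact: subset_itv_oo_cc.
move=> /integrableP[_]; apply: le_lt_trans; rewrite /sqL2norm.
rewrite le_eqVlt; apply/orP; left; apply/eqP; apply: eq_integral => x _ /=.
by rewrite ger0_norm ?sqr_ge0.
Qed.

(** The boundary terms vanish because the support of [w] lies in the open section, so that [w] is 0
    at both endpoints. *)
Lemma test_parts a w chi : 0 < a -> smooth chi -> test_function (section a) w ->
  (\int[leb1 R]_(x in section a) (w x * D1 tt chi x)%:E =
   - \int[leb1 R]_(x in section a) (D1 tt w x * chi x)%:E)%E.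
Proof.
move=> a0 schi [sw [A [_ As w0]]].
have cD (g : R -> R) : smooth g -> continuous (D1 tt g).
  by move=> sg; exact/smooth_continuous/smooth_derive.
have LR g : smooth g -> derivable_oo_LRcontinuous g (- a) a.
  move=> sg; split; first by move=> x _; exact: smooth_derivable.
    apply: cvg_at_right_filter; exact: smooth_continuous.
  apply: cvg_at_left_filter; exact: smooth_continuous.
have out x : x = a \/ x = - a -> w x = 0.
  move=> xa; apply: w0 => /As; rewrite /section/= in_itv/=.
  by case: xa => ->; rewrite ?ltxx ?andbF.
have := @integration_by_parts R w chi (D1 tt w) (D1 tt chi) (- a) a.
rewrite !out; [|by right|by left]; rewrite !mul0r subrr sub0e => H.
have mc (g : R -> R) : continuous g -> measurable_fun (`]- a, a[%classic : set mR) (EFin \o g).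
  move=> cg; apply/measurable_EFinP.
  have h : measurable_fun (setT : set mR) g by exact: continuous_measurable_fun.
  exact: measurable_funTS h.
have cM (g h : R -> R) : continuous g -> continuous h -> continuous (fun x => g x * h x : R).
  by move=> cg ch x; apply: cvgM; [exact: cg|exact: ch].
have bo (g : R -> R) : continuous g -> (\int[leb1 R]_(x in section a) (g x)%:E =
    \int[lebesgue_measure]_(x in `[(- a)%R, a]) (g x)%:E)%E.
  by move=> cg; exact: (esym (@integral_itv_bndoo R (- a) a (EFin \o g) true false (mc _ cg))).
rewrite (bo (fun x => w x * D1 tt chi x)); last first.
  by apply: cM; [exact: smooth_continuous|exact: cD].
rewrite (bo (fun x => D1 tt w x * chi x)); last first.
  by apply: cM; [exact: cD|exact: smooth_continuous].
apply: H.
- by rewrite gtrN.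
- by apply: continuous_subspaceT; exact: cD.
- exact: (LR w sw).
- by move=> x _; rewrite derive1E.
- by apply: continuous_subspaceT; exact: cD.
- exact: (LR chi schi).
- by move=> x _; rewrite derive1E.
Qed.

Lemma test_H10 a w : 0 < a -> test_function (section a) w ->
  H10 (leb1 R) (section a) (test_function (section a)) (@D1 R) w (fun=> D1 tt w).
Proof.
move=> a0 tw; have sw : smooth w by case: tw.
split.
  split; first exact/continuous_L2/smooth_continuous.
    by move=> _; apply: continuous_L2 => //; apply/smooth_continuous/smooth_derive.
  move=> [] chi [schi _]; exact: test_parts.
have z (g : R -> R) : sqL2norm (leb1 R) (section a) (g \- g) = 0%E.
  by rewrite /sqL2norm; apply: integral0_eq => x _; rewrite /= subrr expr0n.
by exists (fun=> w); split=> //= [|[]]; rewrite z; exact: cvg_cst.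
Qed.

Lemma test0 a : test_function (section a) (fun=> 0 : R).
Proof. by split; [exact: smooth0|exists set0; split => //; exact: compact0]. Qed.

Lemma test_H10C a w : 0 < a -> test_function (section a) w ->
  H10_section a (fun t => Complex (w t) 0) (fun t => Complex (D1 tt w t) 0).
Proof.
move=> a0 tw; split; first exact: test_H10.
have := test_H10 a0 (test0 a); rewrite (_ : D1 tt (fun=> 0) = fun=> 0)//.
by apply/funext => x; rewrite /D1 derive_cst.
Qed.

End test_functions_section.

Section rayleigh.
Context (R : realType).
Local Notation mR := (measurableTypeR R).
Local Notation T2 := (mR * mR)%type.
Implicit Types (f : R * R -> R) (u : R -> R[i]).

Lemma strip_section a (x t : R) : section a t -> strip a (x, t).
Proof. by rewrite /section/strip/= in_itv. Qed.

Lemma measurable_slice2 a f (x : R) : measurable_fun (strip a : set T2) f ->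
  measurable_fun (section a : set mR) (fun t => f (x, t)).
Proof.
move=> mf; have mf0 := (measurable_restrictT f (measurable_strip a)).1 mf.
have h : measurable_fun (section a : set mR) (fun t => (f \_ (strip a)) (x, t)).
  by apply: measurable_funTS; exact: (measurable_fun_pair2 x mf0).
apply: eq_measurable_fun h => t; rewrite inE => ta.
by rewrite patchE mem_set//; exact: strip_section.
Qed.

Lemma measurable_slice1 a f (t : R) : section a t -> measurable_fun (strip a : set T2) f ->
  measurable_fun (setT : set mR) (fun x => f (x, t)).
Proof.
move=> ta mf; have mf0 := (measurable_restrictT f (measurable_strip a)).1 mf.
have h : measurable_fun (setT : set mR) (fun x => (f \_ (strip a)) (x, t)).
  exact: (measurable_fun_pair1 t mf0).
apply: eq_measurable_fun h => x _.
by rewrite patchE mem_set//; exact: strip_section.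
Qed.

Lemma sqmod_ge0 (z : R[i]) : 0 <= sqmod z.
Proof. by rewrite /sqmod addr_ge0 ?sqr_ge0. Qed.

Definition wnorm a (g : R -> R) u : R :=
  fine (\int[leb1 R]_(t in section a) (sqmod (u t) * g t)%:E).

Lemma sqmod_integrable a (g : R -> R) (M : R) u :
  L2 (leb1 R) (section a) (fun t => complex.Re (u t)) ->
  L2 (leb1 R) (section a) (fun t => complex.Im (u t)) ->
  measurable_fun (section a : set mR) g ->
  (forall t, section a t -> `|g t| <= M) ->
  (leb1 R).-integrable (section a) (EFin \o (fun t => sqmod (u t) * g t)).
Proof.
move=> [mr r2] [mi i2] mg gM.
have mS := measurable_section a.
have sqi (h : R -> R) : measurable_fun (section a : set mR) h ->
    (sqL2norm (leb1 R) (section a) h < +oo)%E ->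
    (leb1 R).-integrable (section a) (EFin \o (fun t => h t ^+ 2)).
  move=> mh h2; apply/integrableP; split.
    by apply/measurable_EFinP; exact: measurable_funX.
  apply: le_lt_trans h2; rewrite le_eqVlt; apply/orP; left; apply/eqP.
  by apply: eq_integral => t _ /=; rewrite ger0_norm ?sqr_ge0.
have iD : (leb1 R).-integrable (section a) (EFin \o (fun t => M * sqmod (u t))).
  have := integrableZl mS M (integrableD mS (sqi _ mr r2) (sqi _ mi i2)).
  by apply: eq_integrable.
apply: le_integrable iD => //.
  apply/measurable_EFinP/measurable_funM => //.
  by apply: measurable_funD; exact: measurable_funX.
move=> t ta /=; rewrite lee_fin !normrM mulrC ler_wpM2r//.
by rewrite (le_trans (gM t ta))// ler_norm.
Qed.

Lemma wnorm_ge0 a (g : R -> R) u : (forall t, section a t -> 0 <= g t) -> 0 <= wnorm a g u.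
Proof.
move=> g0; apply: fine_ge0; apply: integral_ge0 => t ta.
by rewrite lee_fin mulr_ge0 ?sqmod_ge0 ?g0.
Qed.

Lemma wnorm_le a (g h : R -> R) (M lam : R) u :
  L2 (leb1 R) (section a) (fun t => complex.Re (u t)) ->
  L2 (leb1 R) (section a) (fun t => complex.Im (u t)) ->
  measurable_fun (section a : set mR) g -> measurable_fun (section a : set mR) h ->
  (forall t, section a t -> `|g t| <= M) -> (forall t, section a t -> `|h t| <= M) ->
  (forall t, section a t -> g t <= lam * h t) -> wnorm a g u <= lam * wnorm a h u.
Proof.
move=> ur ui mg mh gM hM gh; have mS := measurable_section a.
have ig := sqmod_integrable ur ui mg gM; have ih := sqmod_integrable ur ui mh hM.
have := @RintegralZl _ _ _ (leb1 R) (section a) _ lam mS ih.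
rewrite /wnorm {2}/Rintegral => <-; apply: le_Rintegral => //.
  by have := integrableZl mS lam ih.
by move=> t ta; rewrite mulrCA ler_wpM2l ?sqmod_ge0 ?gh.
Qed.

Definition rayleigh_set a f (x : R) : set R :=
  [set r | exists phi phi' : R -> R[i],
     [/\ H10_section a phi phi', ~ {ae leb1 R, forall t, section a t -> phi t = 0} &
      r = wnorm a (fun t => f (x, t)) phi' / wnorm a (fun t => f (x, t)) phi]].

Lemma muK_E1 a f (x : R) : muK a f x + E1 a = inf (rayleigh_set a f x).
Proof. by rewrite /muK subrK. Qed.

Lemma H10_section_L2 a (phi phi' : R -> R[i]) : H10_section a phi phi' ->
  [/\ L2 (leb1 R) (section a) (fun t => complex.Re (phi t)),
      L2 (leb1 R) (section a) (fun t => complex.Im (phi t)),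
      L2 (leb1 R) (section a) (fun t => complex.Re (phi' t)) &
      L2 (leb1 R) (section a) (fun t => complex.Im (phi' t))].
Proof.
by move=> [[[r1 r2 _] _] [[i1 i2 _] _]]; split => //; [exact: (r2 tt)|exact: (i2 tt)].
Qed.

Section bounded_weight.
Context (a m M L : R) (f : R * R -> R).
Hypotheses (a0 : 0 < a) (m0 : 0 < m) (mf : measurable_fun (strip a : set T2) f).
Hypotheses (fm : forall z, strip a z -> m <= f z) (fM : forall z, strip a z -> f z <= M).
Hypothesis (fL : forall x s t : R, section a s -> section a t ->
  `|f (x, t) - f (x, s)| <= L * `|t - s|).

Let f_gt0 x t : section a t -> 0 < f (x, t).
Proof. by move=> ta; apply: lt_le_trans m0 (fm (strip_section x ta)). Qed.

Let f_norm x t : section a t -> `|f (x, t)| <= M.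
Proof. by move=> ta; rewrite gtr0_norm ?f_gt0 ?fM//; exact: strip_section. Qed.

Let rayleigh_ge0 x : lbound (rayleigh_set a f x) 0.
Proof.
move=> _ [phi [phi' [_ _ ->]]].
by rewrite divr_ge0// wnorm_ge0// => t ta; rewrite ltW ?f_gt0.
Qed.

Lemma muK_test x w : test_function (section a) w ->
  ((muK a f x + E1 a)%:E * \int[leb1 R]_(t in section a) (w t ^+ 2 * f (x, t))%:E <=
   \int[leb1 R]_(t in section a) (D1 tt w t ^+ 2 * f (x, t))%:E)%E.
Proof.
move=> tw; have H := test_H10C a0 tw.
have [r1 i1 r2 i2] := H10_section_L2 H.
have mfx := measurable_slice2 x mf.
have fMx := f_norm x.
have mS := measurable_section a.
have I1 := integrable_fin_num mS (sqmod_integrable r1 i1 mfx fMx).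
have I2 := integrable_fin_num mS (sqmod_integrable r2 i2 mfx fMx).
have sq (g : R -> R) t : sqmod (Complex (g t) 0) = g t ^+ 2.
  by rewrite /sqmod/= expr0n addr0.
have e (g : R -> R) : (\int[leb1 R]_(t in section a) (g t ^+ 2 * f (x, t))%:E =
    \int[leb1 R]_(t in section a) (sqmod (Complex (g t) 0) * f (x, t))%:E)%E.
  by apply: eq_integral => t _; rewrite sq.
rewrite !e -(fineK I1) -(fineK I2) -EFinM lee_fin.
rewrite -/(wnorm a (fun t => f (x, t)) (fun t => Complex (w t) 0)).
rewrite -/(wnorm a (fun t => f (x, t)) (fun t => Complex (D1 tt w t) 0)).
have w0 u : 0 <= wnorm a (fun t => f (x, t)) u.
  by apply: wnorm_ge0 => t ta; rewrite ltW ?f_gt0.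
(* A zero denominator makes the left-hand side 0. A non-zero one shows that [w] is not almost
   everywhere 0, hence that its quotient belongs to the set whose infimum is taken. *)
have [->|D0] := eqVneq (wnorm a (fun t => f (x, t)) (fun t => Complex (w t) 0)) 0.
  by rewrite mulr0.
rewrite -ler_pdivlMr ?lt_def ?D0 ?w0// muK_E1.
apply: ge_inf; first by exists 0; exact: rayleigh_ge0.
do 2 eexists; split; [exact: H| |reflexivity].
move=> ae0; move/eqP : D0; apply; rewrite /wnorm.
rewrite (ae_eq_integral (cst 0%E))//; first by rewrite integral0.
- exact: measurable_int (sqmod_integrable r1 i1 mfx fMx).
- apply: (@filterS _ _ (ae_filter_ringOfSetsType (leb1 R)) _ _ _ ae0) => t h ta.
  by rewrite h// /sqmod/= expr0n/= addr0 mul0r.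
Qed.

(** The admissible [phi] are the same for [x] and [y]. Passing from one weight to the other costs a
    factor [lam] in the numerator and another in the denominator of each quotient. *)
Lemma muK_compare x y (lam : R) : 1 <= lam ->
  (forall t, section a t -> f (x, t) <= lam * f (y, t)) ->
  (forall t, section a t -> f (y, t) <= lam * f (x, t)) ->
  muK a f x + E1 a <= lam ^+ 2 * (muK a f y + E1 a).
Proof.
move=> lam1 fxy fyx; rewrite !muK_E1.
have lam0 : 0 < lam by apply: lt_le_trans lam1.
have w0 z u : 0 <= wnorm a (fun t => f (z, t)) u.
  by apply: wnorm_ge0 => t ta; rewrite ltW ?f_gt0.
have lbx : has_lbound (rayleigh_set a f x) by exists 0; exact: rayleigh_ge0.
(* [inf] of the empty set is 0 by convention; the two sets are empty together since admissibility
   does not depend on the weight. *)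
have [y0|/set0P ne] := eqVneq (rayleigh_set a f y) set0.
  suff -> : rayleigh_set a f x = set0 by rewrite y0 inf0 mulr0.
  apply/seteqP; split => // r [phi [phi' [h1 h2 _]]].
  suff : rayleigh_set a f y (wnorm a (fun t => f (y, t)) phi' / wnorm a (fun t => f (y, t)) phi).
    by rewrite y0.
  by exists phi, phi'.
rewrite mulrC -ler_pdivrMr ?exprn_gt0//; apply: lb_le_inf => //.
move=> _ [phi [phi' [h1 h2 ->]]].
rewrite ler_pdivrMr ?exprn_gt0//.
apply: (@le_trans _ _ (wnorm a (fun t => f (x, t)) phi' / wnorm a (fun t => f (x, t)) phi)).
  by apply: ge_inf => //; exists phi, phi'.
have [r1 i1 r2 i2] := H10_section_L2 h1.
have N := wnorm_le r2 i2 (measurable_slice2 x mf) (measurable_slice2 y mf)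
  (f_norm x) (f_norm y) fxy.
have D := wnorm_le r1 i1 (measurable_slice2 y mf) (measurable_slice2 x mf)
  (f_norm y) (f_norm x) fyx.
have D' := wnorm_le r1 i1 (measurable_slice2 x mf) (measurable_slice2 y mf)
  (f_norm x) (f_norm y) fxy.
move: N D D' (w0 x phi) (w0 y phi) (w0 x phi') (w0 y phi').
set Nx := wnorm a (fun t => f (x, t)) phi'; set Dx := wnorm a (fun t => f (x, t)) phi.
set Ny := wnorm a (fun t => f (y, t)) phi'; set Dy := wnorm a (fun t => f (y, t)) phi.
move=> N D D' Dx0 Dy0 Nx0 Ny0.
(* Division by 0 yields 0, so the quotient at [x] is then below any non-negative number. *)
have [Dx00|Dx00] := eqVneq Dx 0.
  by rewrite Dx00 invr0 mulr0 mulr_ge0 ?divr_ge0 ?sqr_ge0.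
have Dxp : 0 < Dx by rewrite lt_def Dx00.
have Dyp : 0 < Dy by rewrite -(pmulr_rgt0 _ lam0); exact: lt_le_trans D'.
rewrite ler_pdivrMr// mulrAC -mulrA mulrAC ler_pdivlMr//.
apply: le_trans (ler_pM Nx0 Dy0 N D) _.
by rewrite le_eqVlt; apply/orP; left; apply/eqP; ring.
Qed.

(* The slices [f (x, _)] are uniformly Lipschitz, so finitely many of their
   values, rounded, determine them up to a small error; on each of the
   countably many measurable cells so obtained [muK] varies little. *)
Let node n i : R := a * (i.*2.+1%:R / n.+1%:R - 1).

Let node_section n i : (i < n.+1)%N -> section a (node n i).
Proof.
move=> i_n; apply/section_norm; rewrite /node normrM gtr0_norm// gtr_pMr//.
rewrite ltr_norml ltrBlDr ltrBrDr addNr.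
rewrite divr_gt0//= ltr_pdivrMr// -(natrD _ 1 1) -natrM ltr_nat addn1 mul2n.
by rewrite doubleS ltnS ltnS leq_double.
Qed.

Let node_close n t : section a t -> exists2 i, (i < n.+1)%N & `|t - node n i| <= a / n.+1%:R.
Proof.
(* [s] rescales the section to [[0, n + 1)]: its integer part is the index of the piece containing
   [t], and the node is the mid-point of that piece. *)
move=> /section_norm ta; pose s := (t + a) * n.+1%:R / (2 * a).
have s0 : 0 <= s.
  rewrite divr_ge0 ?mulr_ge0 ?(ltW a0)//.
  by move: ta; rewrite ltr_norml => /andP[? _]; lra.
have sn : s < n.+1%:R.
  rewrite ltr_pdivrMr ?mulr_gt0// mulrC ltr_pM2l//.
  by move: ta; rewrite ltr_norml => /andP[_ ?]; lra.
exists (Num.truncn s); first by rewrite -(ltr_nat R) (le_lt_trans _ sn)// truncn_le.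
have /andP[h1 h2] := truncn_itv s0.
have n0 : 0 < n.+1%:R :> R by [].
have tE : t = a * (2 * s / n.+1%:R - 1).
  have: forall N : R, 0 < N -> t = a * (2 * ((t + a) * N / (2 * a)) / N - 1).
    by move=> N N0; field; rewrite !gt_eqF.
  exact.
rewrite [in X in `|X|]tE /node -mulrBr normrM gtr0_norm// ler_pM2l//.
rewrite opprB addrA subrK -mulrBl normrM normfV (gtr0_norm n0).
rewrite ler_pdivrMr// mulVf ?gt_eqF// -[_.*2.+1]addn1 natrD -mul2n natrM.
move: h1 h2; rewrite -[_.+1]addn1 natrD => h1 h2.
by rewrite ler_norml; apply/andP; split; lra.
Qed.

Let cell (p : nat * seq int) : set mR :=
  [set x | forall i, (i < p.1.+1)%N -> Num.floor (f (x, node p.1 i) * p.1.+1%:R) = nth 0 p.2 i].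

Let measurable_cell p : measurable (cell p).
Proof.
rewrite (_ : cell p = \bigcap_(i in `I_p.1.+1)
   [set x | (nth 0 p.2 i)%:~R <= f (x, node p.1 i) * p.1.+1%:R < (nth 0 p.2 i + 1)%:~R]).
  apply: bigcap_measurable; first by exists 0%N.
  move=> i /= ip; have mg := measurable_slice1 (node_section ip) mf.
  rewrite (_ : [set x | _] = setT `&` (fun x => f (x, node p.1 i) * p.1.+1%:R) @^-1`
    `[(nth 0 p.2 i)%:~R, (nth 0 p.2 i + 1)%:~R[%classic).
    have mh : measurable_fun (setT : set mR) (fun x => f (x, node p.1 i) * p.1.+1%:R).
      by apply: measurable_funM => //; exact: measurable_cst.
    by apply: mh => //; exact: measurable_itv.
  by rewrite setTI; apply/seteqP; split => x /=; rewrite in_itv.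
apply/seteqP; split => x /= h i ip; have := h i ip.
- by move/eqP; rewrite floor_eq.
- by move=> /=; rewrite -floor_eq => /eqP.
Qed.

Let L_ge0 : 0 <= L.
Proof.
have sa : section a (a / 2).
  by apply/section_norm; rewrite gtr0_norm ?divr_gt0// ltr_pdivrMr// ltr_pMr// ltr1n.
have := le_trans (normr_ge0 _) (fL 0 (section0 a0) sa).
by rewrite subr0 pmulr_lge0// normr_gt0 gt_eqF// divr_gt0.
Qed.

(** Equal rounded values at a node differ by at most 1 / (n + 1); moving from [t] to the nearby node
    costs [L a / (n + 1)] once for [x] and once for [y]. *)
Let cell_close p x y : cell p x -> cell p y -> forall t, section a t ->
  `|f (x, t) - f (y, t)| <= (1 + 2 * L * a) / p.1.+1%:R.
Proof.
move=> cx cy t ta; have [i ip ti] := node_close p.1 ta.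
have n0 : 0 < p.1.+1%:R :> R by [].
have h1 : `|f (x, node p.1 i) - f (y, node p.1 i)| <= p.1.+1%:R^-1.
  have /andP[x1 x2] := floor_itv (f (x, node p.1 i) * p.1.+1%:R).
  have /andP[y1 y2] := floor_itv (f (y, node p.1 i) * p.1.+1%:R).
  move: x1 x2 y1 y2; rewrite cx// cy// rmorphD/= => x1 x2 y1 y2.
  rewrite -(ler_pM2r n0) mulVf ?gt_eqF// -{1}(gtr0_norm n0) -normrM mulrBl.
  by rewrite ler_norml; apply/andP; split; lra.
have h3 z : `|f (z, t) - f (z, node p.1 i)| <= L * (a / p.1.+1%:R).
  by apply: le_trans (fL z (node_section ip) ta) _; rewrite ler_wpM2l ?L_ge0.
have -> : f (x, t) - f (y, t) = (f (x, t) - f (x, node p.1 i)) +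
  (f (x, node p.1 i) - f (y, node p.1 i)) - (f (y, t) - f (y, node p.1 i)) by ring.
apply: (le_trans (ler_normB _ _)).
apply: (@le_trans _ _ (L * (a / p.1.+1%:R) + p.1.+1%:R^-1 + L * (a / p.1.+1%:R))).
  by rewrite lerD// (le_trans (ler_normD _ _))// lerD.
by rewrite le_eqVlt; apply/orP; left; apply/eqP; field; rewrite gt_eqF.
Qed.

(** A superlevel set is the union of the cells contained in it, a countable union since cells are
    indexed by [nat * seq int]. Each point with [r < muK] lies in such a cell: the strict inequality
    leaves room for the factor of [muK_compare] once [n] is large. *)
Lemma measurable_muK : measurable_fun (setT : set mR) (muK a f).
Proof.
apply: (measurability _ (RGenOInfty.measurableE R)).
move=> _ [_ [r ->] <-]; rewrite setTI.
rewrite (_ : muK a f @^-1` _ = \bigcup_(p in [set p | cell p `<=` [set x | r < muK a f x]]) cell p).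
  rewrite bigcup_mkcond; apply: countable_bigcupT_measurable => // p.
  by case: ifP => // _; exact: measurable_cell.
apply/seteqP; split => [x /=|x [p /= sub cx]]; last first.
  by rewrite in_itv/= andbT; exact: sub.
rewrite in_itv/= andbT => rx.
(* Dividing by the lower bound [m] of [f] turns the additive error of [cell_close] into the relative
   error [C / (n + 1)]. *)
pose C := (1 + 2 * L * a) / m.
have cvl : (1 + C / n.+1%:R) ^+ 2 * (r + E1 a) @[n --> \oo] --> r + E1 a.
  suff : (1 + C / n.+1%:R) ^+ 2 * (r + E1 a) @[n --> \oo] -->
      (1 + C * 0) * (1 + C * 0) * (r + E1 a) by rewrite mulr0 addr0 !mul1r.
  have cinv : n.+1%:R^-1 @[n --> \oo] --> (0 : R) by exact: cvg_harmonic.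
  have cC : C / n.+1%:R @[n --> \oo] --> C * 0 by apply: cvgM; [exact: cvg_cst|exact: cinv].
  have c1 : 1 + C / n.+1%:R @[n --> \oo] --> 1 + C * 0 by apply: cvgD; [exact: cvg_cst|exact: cC].
  by apply: cvgM; [apply: cvgM; exact: c1|exact: cvg_cst].
have C0 n : 0 <= C / n.+1%:R by rewrite divr_ge0// divr_ge0 ?(ltW m0)// addr_ge0 ?mulr_ge0 ?(ltW a0).
have [n hn] : exists n, (1 + C / n.+1%:R) ^+ 2 * (r + E1 a) < muK a f x + E1 a.
  have : r + E1 a < muK a f x + E1 a by rewrite ltrD2r.
  move=> /(cvgr_lt _ cvl)[N _ hN]; exists N; exact: (hN N (leqnn N)).
pose p := (n, [seq Num.floor (f (x, node n i) * n.+1%:R) | i <- iota 0 n.+1]).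
have cx : cell p x.
  by move=> i ip; rewrite (nth_map 0%N) ?size_iota// nth_iota.
exists p => // y cy /=.
have lam z z' : cell p z -> cell p z' -> forall t, section a t ->
    f (z, t) <= (1 + C / n.+1%:R) * f (z', t).
  move=> cz cz' t ta; have := cell_close cz cz' ta; rewrite ler_norml => /andP[_ h].
  rewrite mulrDl mul1r -lerBlDl; apply: (@le_trans _ _ (C / n.+1%:R * m)).
    apply: (le_trans h); rewrite /C le_eqVlt; apply/orP; left; apply/eqP.
    have : n.+1%:R != 0 :> R by [].
    by move: n.+1%:R => k k0 /=; field; rewrite k0 gt_eqF.
  by rewrite ler_wpM2l//; exact/fm/strip_section.
have := muK_compare _ (lam _ _ cx cy) (lam _ _ cy cx).
rewrite lerDl => /(_ (C0 n)) /(lt_le_trans hn).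
by rewrite ltr_pM2l ?ltrD2r// exprn_gt0// ltr_wpDr.
Qed.

End bounded_weight.
End rayleigh.

(** * One-dimensional Hardy inequalities *)

Section hardy.
Context (R : realType).
Local Notation mR := (measurableTypeR R).
Implicit Types (w : R -> R) (b c d e : R).

(* Expand [0 <= (w' + g w)^2] with the ground state [g x = e / (2 (1 - e (x - b)))],
   for which [g' - g^2 = 1 / (4 (1 - e (x - b))^2)]. *)
Lemma hardy_segment e b c d w : e ^+ 2 = 1 -> c < d ->
  (forall x, x \in `[c, d] -> 0 < 1 - e * (x - b)) -> smooth w ->
  \int[leb1 R]_(x in `[c, d]) (w x ^+ 2 / (4 * (1 - e * (x - b)) ^+ 2)) <=
  \int[leb1 R]_(x in `[c, d]) (D1 tt w x ^+ 2) +
    (e / (2 * (1 - e * (d - b))) * w d ^+ 2 - e / (2 * (1 - e * (c - b))) * w c ^+ 2).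
Proof.
move=> e1 cd pos sw; pose g (x : R) : R := e / (2 * (1 - e * (x - b))).
rewrite -/(g d) -/(g c).
set w' := D1 tt w.
have sw' : smooth w' by exact: smooth_derive.
have cw := smooth_continuous sw; have cw' := smooth_continuous sw'.
pose F x := g x * w x ^+ 2.
pose f x := w x ^+ 2 / (2 * (1 - e * (x - b)) ^+ 2) + 2 * g x * w x * w' x.
have cl : continuous (fun x : R => 1 - e * (x - b)).
  move=> x; apply: cvgB; first exact: cvg_cst.
  apply: cvgM; first exact: cvg_cst.
  by apply: cvgB; [exact: cvg_id|exact: cvg_cst].
have cg x : x \in `[c, d] -> {for x, continuous g}.
  move=> xcd; apply: cvgM; first exact: cvg_cst.
  apply: cvgV; first by rewrite mulf_neq0// gt_eqF// pos.
  by apply: cvgM; [exact: cvg_cst|exact: cl].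
have cx2 (h : R -> R) x : {for x, continuous h} -> {for x, continuous (fun x => h x ^+ 2)}.
  by move=> ch; exact: (continuous_comp ch (@exprn_continuous R 2 (h x))).
have cq (k : R) x : k != 0 -> x \in `[c, d] ->
    {for x, continuous (fun x => w x ^+ 2 / (k * (1 - e * (x - b)) ^+ 2))}.
  move=> k0 xcd; apply: cvgM; first by apply: cx2; exact: cw.
  apply: cvgV; first by rewrite mulf_neq0// expf_neq0// gt_eqF// pos.
  apply: cvgM; first exact: cvg_cst.
  by apply: (cx2 (fun x => 1 - e * (x - b))); exact: cl.
have cf x : x \in `[c, d] -> {for x, continuous f}.
  move=> xcd; apply: cvgD; first by apply: cq.
  apply: cvgM; last exact: cw'.
  apply: cvgM; last exact: cw.
  by apply: cvgM; [exact: cvg_cst|exact: cg].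
have cF x : x \in `[c, d] -> {for x, continuous F}.
  by move=> xcd; apply: cvgM; [exact: cg|apply: cx2; exact: cw].
have win (h : R -> R) : (forall x, x \in `[c, d] -> {for x, continuous h}) ->
    {within `[c, d], continuous h}.
  move=> ch; apply: continuous_in_subspaceT => x; rewrite inE/= => xcd; exact: ch.
have int (h : R -> R) : (forall x, x \in `[c, d] -> {for x, continuous h}) ->
    (leb1 R).-integrable `[c, d] (EFin \o h).
  move=> ch; apply: continuous_compact_integrable; first exact: segment_compact.
  exact: win.
have dF (x : R) : x \in `[c, d] -> is_derive x 1 F (f x).
  move=> xcd; have p := pos x xcd.
  have dl : is_derive x 1 (fun x : R => 1 - e * (x - b)) (- e).
    have dxb : is_derive x 1 (fun x : R => x - b) 1.
      by have := is_deriveB (is_derive_id x 1) (is_derive_cst b x 1); rewrite subr0.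
    have := is_deriveB (is_derive_cst (1 : R) x 1) (@is_deriveZ _ _ _ _ e x 1 _ dxb).
    by rewrite sub0r [e *: 1]mulr1.
  have dlV := @is_deriveV R _ x _ 1 (lt0r_neq0 p) dl.
  have dw2 : is_derive x 1 (fun x => w x ^+ 2) (2 * w x * w' x).
    have := @is_deriveX _ _ w 2 x 1 _ (smooth_is_derive x sw).
    by rewrite fctE expr1.
  have dgw := is_deriveM (@is_deriveZ _ _ _ _ (e / 2) x 1 _ dlV) dw2.
  have -> : F = (fun x => e / 2 * (1 - e * (x - b))^-1) * (fun x => w x ^+ 2).
    apply/funext => y; rewrite /F /g.
    by rewrite -[RHS]/(e / 2 * (1 - e * (y - b))^-1 * w y ^+ 2) invfM !mulrA.
  apply: (is_derive_eq dgw).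
  rewrite /GRing.scale/= /GRing.scale/= /f /g; move: e1 (lt0r_neq0 p); move: (1 - e * (x - b)) => l e1 l0.
  have -> : w x ^+ 2 / (2 * l ^+ 2) = e ^+ 2 * w x ^+ 2 / (2 * l ^+ 2) by rewrite e1 mul1r.
  by field.
have FTC : \int[leb1 R]_(x in `[c, d]) f x = F d - F c.
  rewrite /Rintegral (@continuous_FTC2 _ f F)//.
  - exact: win.
  - have ccd : c \in `[c, d] by rewrite in_itv/= lexx ltW.
    have dcd : d \in `[c, d] by rewrite in_itv/= lexx ltW.
    split.
    + move=> x xcd; have [] := dF x (subset_itv_oo_cc xcd); by [].
    + by apply: cvg_at_right_filter; exact: cF.
    + by apply: cvg_at_left_filter; exact: cF.
  - move=> x xcd; rewrite derive1E; have := dF x (subset_itv_oo_cc xcd) => H.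
    by rewrite derive_val.
have mI : measurable (`[c, d]%classic : set mR) by exact: measurable_itv.
have i1 : (leb1 R).-integrable `[c, d] (EFin \o (fun x => w' x ^+ 2)).
  by apply: int => x _; apply: cx2; exact: cw'.
have i2 : (leb1 R).-integrable `[c, d] (EFin \o f) by exact: int.
rewrite -FTC -RintegralD//; apply: le_Rintegral => //.
- by apply: int => x xcd; exact: cq.
- by apply: int => x xcd; apply: cvgD; [apply: cx2; exact: cw'|exact: cf].
move=> x xcd; rewrite /f /g; have := lt0r_neq0 (pos x xcd).
move: e1; move: (1 - e * (x - b)) => l e1 l0.
rewrite -subr_ge0.
have -> : w' x ^+ 2 + (w x ^+ 2 / (2 * l ^+ 2) + 2 * (e / (2 * l)) * w x * w' x) -
  w x ^+ 2 / (4 * l ^+ 2) = (w' x + e / (2 * l) * w x) ^+ 2 +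
    (1 - e ^+ 2) * w x ^+ 2 / (4 * l ^+ 2) by field.
by rewrite e1 subrr !mul0r addr0 sqr_ge0.
Qed.

(** The common endpoint [b] is a null set, so both pieces can be taken closed, as the fundamental
    theorem of calculus on segments requires. *)
Lemma integral_split (h : R -> R) (N b : R) : - N < b < N ->
  measurable_fun (setT : set mR) h -> (forall x, 0 <= h x) ->
  (forall x, N <= `|x| -> h x = 0) ->
  (\int[leb1 R]_x (h x)%:E = \int[leb1 R]_(x in `[(- N)%R, b]) (h x)%:E +
    \int[leb1 R]_(x in `[b, N]) (h x)%:E)%E.
Proof.
move=> /andP[Nb bN] mh h0 hN.
have mhD (D : set mR) : measurable_fun D (EFin \o h).
  by apply/measurable_EFinP; exact: measurable_funTS.
have -> : (\int[leb1 R]_x (h x)%:E = \int[leb1 R]_(x in `[(- N)%R, b[ `|` `[b, N]) (h x)%:E)%E.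
  rewrite [RHS]integral_mkcond; apply: eq_integral => x _; rewrite patchE.
  case: ifPn => //; rewrite notin_setE/= => xN; rewrite hN//.
  rewrite leNgt; apply/negP; rewrite ltr_norml => /andP[Nx xN'].
  apply: xN; rewrite !in_itv/=; case: (ltP x b) => xb; [left|right] => //.
    by rewrite ltW.
  by rewrite ltW.
rewrite ge0_integral_setU//.
- congr (_ + _)%E.
  have e0 (b0 b1 : bool) := @integral_itv_bndoo R (- N) b (EFin \o h) b0 b1 (mhD _).
  exact: (etrans (e0 true true) (esym (e0 true false))).
- by move=> x _; rewrite lee_fin.
- rewrite disj_set2E; apply/eqP/seteqP; split => x //= [].
  by rewrite !in_itv/= => /andP[_ xb] /andP[bx _]; move: (lt_le_trans xb bx); rewrite ltxx.
Qed.

(** [hardy_segment] is used with [e = 1] to the left of [b] and [e = -1] to the right. Each side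
    contributes [w b ^+ 2 / 2] at [b], together the jump at [b] of the logarithmic derivative of the
    ground state; the outer boundary terms vanish. *)
Lemma hardy_line w (N b : R) : smooth w -> (forall x, N <= `|x| -> w x = 0) ->
  (\int[leb1 R]_x (w x ^+ 2 / (4 * (1 + `|x - b|) ^+ 2))%:E <=
   \int[leb1 R]_x (D1 tt w x ^+ 2)%:E + (w b ^+ 2)%:E)%E.
Proof.
move=> sw wN0.
(* Strictly larger than [|b|], so that [b] is interior, and than [N], so that the derivative of [w]
   vanishes from [N'] on as well. *)
pose N' := Num.max N `|b| + 1.
have bN : `|b| < N' by rewrite /N' ltr_pwDr// le_max lexx orbT.
have NN : N < N' by rewrite /N' ltr_pwDr// le_max lexx.
have wN x : N' <= `|x| -> w x = 0 by move=> /(lt_le_trans NN)/ltW; exact: wN0.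
have dwN x : N' <= `|x| -> D1 tt w x = 0.
  move=> Nx; rewrite /D1 (_ : 0 = 'D_1 (cst (0 : R)) x); last by rewrite derive_cst.
  have Nlt : N < `|x| by exact: lt_le_trans Nx.
  apply: near_eq_derive; near=> y; rewrite /cst wN0//; apply: ltW; near: y.
  have cn : `|y| @[y --> x] --> `|x| by apply: cvg_norm; exact: cvg_id.
  exact: (cvgr_gt _ cn _ Nlt).
have bNN : - N' < b < N' by rewrite -ltr_norml.
have [Nb bN'] := andP bNN.
have cw' : continuous (D1 tt w) by exact/smooth_continuous/smooth_derive.
have cw := smooth_continuous sw.
have m1 : measurable_fun (setT : set mR) (fun x => D1 tt w x ^+ 2).
  by apply: measurable_funX; exact: continuous_measurable_fun.
pose h x := w x ^+ 2 / (4 * (1 + `|x - b|) ^+ 2).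
have ch : continuous h.
  move=> x; apply: cvgM.
    exact: (continuous_comp (cw x) (@exprn_continuous R 2 (w x))).
  apply: cvgV; first by rewrite mulf_neq0// expf_neq0// gt_eqF// ltr_pwDl.
  apply: cvgM; first exact: cvg_cst.
  apply: (@continuous_comp _ _ _ (fun x : R => 1 + `|x - b|) (fun y => y ^+ 2));
    last exact: exprn_continuous.
  apply: cvgD; first exact: cvg_cst.
  by apply: cvg_norm; apply: cvgB; [exact: cvg_id|exact: cvg_cst].
have m2 : measurable_fun (setT : set mR) h by exact: continuous_measurable_fun.
have cw'2 : continuous (fun x => D1 tt w x ^+ 2).
  by move=> x; exact: (continuous_comp (cw' x) (@exprn_continuous R 2 _)).
have EfinR c d (k : R -> R) : continuous k ->
    (\int[leb1 R]_(x in `[c, d]) (k x)%:E = (\int[leb1 R]_(x in `[c, d]) k x)%:E)%E.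
  move=> ck; rewrite /Rintegral fineK//; apply: integrable_fin_num; first exact: measurable_itv.
  apply: continuous_compact_integrable; first exact: segment_compact.
  exact: continuous_subspaceT.
have seg e c d : e ^+ 2 = 1 -> c < d -> (forall x, x \in `[c, d] -> `|x - b| = - (e * (x - b))) ->
  (\int[leb1 R]_(x in `[c, d]) (h x)%:E <= \int[leb1 R]_(x in `[c, d]) (D1 tt w x ^+ 2)%:E +
    (e / (2 * (1 - e * (d - b))) * w d ^+ 2 - e / (2 * (1 - e * (c - b))) * w c ^+ 2)%:E)%E.
  move=> e1 cd abs; rewrite !EfinR// -EFinD lee_fin.
  have := @hardy_segment e b c d w e1 cd _ sw.
  rewrite (_ : Rintegral _ _ _ = \int[leb1 R]_(x in `[c, d]) h x); last first.
    by apply: eq_Rintegral => x; rewrite inE => xcd; rewrite /h abs.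
  by apply => x xcd; rewrite -abs// ltr_pwDl.
rewrite (integral_split bNN m2) ?(integral_split bNN m1).
- have s1 := seg 1 (- N') b (expr1n _ _) Nb _.
  have s2 := seg (-1) b N' _ bN' _.
  apply: (le_trans (leeD (s1 _) (s2 _ _))).
  + by move=> x; rewrite in_itv/= mul1r => /andP[_ xb]; rewrite ler0_norm// subr_le0.
  + by rewrite sqrrN expr1n.
  + by move=> x; rewrite in_itv/= mulN1r opprK => /andP[bx _]; rewrite ger0_norm// subr_ge0.
  rewrite (wN (- N')) ?normrN ?ler_norm// (wN N') ?ler_norm//.
  rewrite addeACA leeD2l// -EFinD lee_fin !subrr !(mulr0, subr0, mulr1, expr0n)/=.
  lra.
- by move=> x; rewrite sqr_ge0.
- by move=> x Nx; rewrite dwN// expr0n.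
- by move=> x; rewrite /h divr_ge0 ?sqr_ge0// mulr_ge0// sqr_ge0.
- by move=> x Nx; rewrite /h wN// expr0n mul0r.
Unshelve. all: by end_near. Qed.

(** Moves the centre of the Hardy weight from [b] to the mid-point of the interval, [l] being its
    half-length: (1 + l + d)^2 is at most 2 ((1 + l)^2 + d^2), hence at most 2 (1 + l)^2 (1 + d^2).
    This is the origin of the constant 8. *)
Lemma shift_bound (l d t : R) : 0 <= l -> 0 <= d -> 0 <= t -> t <= d + l ->
  4 * (1 + t) ^+ 2 <= 8 * (1 + l) ^+ 2 * (1 + d ^+ 2).
Proof.
move=> l0 d0 t0 tdl.
have h1 : (1 + t) ^+ 2 <= (1 + l + d) ^+ 2.
  by rewrite ler_sqr ?nnegrE ?addr_ge0//; lra.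
have h2 : d ^+ 2 <= (1 + l) ^+ 2 * d ^+ 2.
  by rewrite ler_peMl ?sqr_ge0// exprn_ege1// lerDl.
have h3 := sqr_ge0 (1 + l - d).
rewrite !expr2 in h1 h2 h3 *; lra.
Qed.

(** Once the weight is centred at the mid-point, the left-hand side of [hardy_line] no longer
    depends on [b]. Integrating over [b] in [B] then merely multiplies it by the measure of [B]. *)
Lemma hardy_average w (N : R) (B : set mR) (j0 j1 : R) : smooth w ->
  (forall x, N <= `|x| -> w x = 0) -> j0 <= j1 -> measurable B -> B `<=` `]j0, j1[%classic ->
  ((leb1 R B * ((8 * (1 + (j1 - j0) / 2) ^+ 2)^-1%:E *
      \int[leb1 R]_x (w x ^+ 2 / (1 + `|x - (j0 + j1) / 2| ^+ 2))%:E)) <=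
    leb1 R B * \int[leb1 R]_x (D1 tt w x ^+ 2)%:E + \int[leb1 R]_(x in B) (w x ^+ 2)%:E)%E.
Proof.
move=> sw wN j01 mB BJ; set k := (8 * _)^-1; set x0 := (j0 + j1) / 2.
have p0 : 0 < 1 + (j1 - j0) / 2 by rewrite ltr_pwDl// divr_ge0// subr_ge0.
have k0 : 0 <= k by rewrite invr_ge0 mulr_ge0// sqr_ge0.
have cw := smooth_continuous sw.
have mw2 : measurable_fun (setT : set mR) (fun x => w x ^+ 2).
  by apply: measurable_funX; exact: continuous_measurable_fun.
have cden (c y : R) : 0 < c -> continuous (fun x : R => c + `|x - y|).
  move=> c0 x; apply: cvgD; first exact: cvg_cst.
  by apply: cvg_norm; apply: cvgB; [exact: cvg_id|exact: cvg_cst].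
have m1 : measurable_fun (setT : set mR) (fun x => w x ^+ 2 / (1 + `|x - x0| ^+ 2)).
  apply: measurable_funM => //; apply: continuous_measurable_fun => x.
  apply: cvgV; first by rewrite gt_eqF// ltr_pwDl// sqr_ge0.
  apply: cvgD; first exact: cvg_cst.
  apply: (@continuous_comp _ _ _ (fun x : R => `|x - x0|) (fun y => y ^+ 2));
    last exact: exprn_continuous.
  by apply: cvg_norm; apply: cvgB; [exact: cvg_id|exact: cvg_cst].
have m2 b : measurable_fun (setT : set mR) (fun x => w x ^+ 2 / (4 * (1 + `|x - b|) ^+ 2)).
  apply: measurable_funM => //; apply: continuous_measurable_fun => x.
  apply: cvgV; first by rewrite mulf_neq0// expf_neq0// gt_eqF// ltr_pwDl.
  apply: cvgM; first exact: cvg_cst.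
  apply: (@continuous_comp _ _ _ (fun x : R => 1 + `|x - b|) (fun y => y ^+ 2));
    [exact: cden|exact: exprn_continuous].
set A := (k%:E * _)%E; set C := (\int[leb1 R]_x (D1 tt w x ^+ 2)%:E)%E.
have C0 : (0 <= C)%E by apply: integral_ge0 => x _; rewrite lee_fin sqr_ge0.
have A0 : (0 <= A)%E.
  rewrite mule_ge0 ?lee_fin//; apply: integral_ge0 => x _.
  by rewrite lee_fin divr_ge0 ?addr_ge0 ?sqr_ge0.
have AC b : B b -> (A <= C + (w b ^+ 2)%:E)%E.
  move=> /BJ /=; rewrite in_itv/= => /andP[jb bj].
  apply: le_trans (hardy_line b sw wN).
  rewrite /A -ge0_integralZl_EFin//; first last.
  - exact/measurable_EFinP.
  - by move=> x _; rewrite lee_fin divr_ge0 ?addr_ge0 ?sqr_ge0.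
  apply: ge0_le_integral => //.
  - by move=> x _; rewrite lee_fin mulr_ge0// divr_ge0 ?addr_ge0 ?sqr_ge0.
  - by apply/measurable_EFinP; apply: measurable_funM.
  - exact/measurable_EFinP.
  move=> x _; rewrite -EFinM lee_fin mulrCA ler_wpM2l ?sqr_ge0//.
  rewrite /k -invfM lef_pV2 ?posrE; last 2 first.
  - by rewrite !mulr_gt0 ?exprn_gt0// ltr_pwDl// sqr_ge0.
  - by rewrite mulr_gt0 ?exprn_gt0// ltr_pwDl// normr_ge0.
  have hb : `|x - b| <= `|x - x0| + (j1 - j0) / 2.
    rewrite -[x - b](subrK (x - x0)) addrC (le_trans (ler_normD _ _))// lerD2l.
    by rewrite /x0 ler_norml; apply/andP; split; lra.
  by apply: shift_bound hb => //; rewrite ?normr_ge0// divr_ge0// subr_ge0.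
have -> : (leb1 R B * A = \int[leb1 R]_(x in B) cst A x)%E by rewrite integral_cst// muleC.
have -> : (leb1 R B * C = \int[leb1 R]_(x in B) cst C x)%E by rewrite integral_cst// muleC.
rewrite -ge0_integralD//.
- apply: ge0_le_integral => //.
  apply: emeasurable_funD => //.
  by apply/measurable_EFinP; exact: measurable_funTS.
- by move=> x _; rewrite lee_fin sqr_ge0.
- by apply/measurable_EFinP; exact: measurable_funTS.
Qed.

End hardy.

(** * Iterated integrals and measurability on the strip *)

Section strip_integrals.
Context (R : realType).
Local Notation mR := (measurableTypeR R).
Local Notation T2 := (mR * mR)%type.
Implicit Types (h : R * R -> \bar R) (a : R).

(** Both orders are provided: the Hardy inequality acts on horizontal lines, with [x] integrated
    first, the spectral inequality on transversal fibres, with [t] integrated first. *)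
Lemma strip_tonelli a h : measurable_fun (strip a : set T2) h ->
  (forall z, strip a z -> (0 <= h z)%E) ->
  [/\ (\int[leb2 R]_(z in strip a) h z =
       \int[leb1 R]_x \int[leb1 R]_(t in section a) h (x, t))%E,
     (\int[leb2 R]_(z in strip a) h z =
       \int[leb1 R]_(t in section a) \int[leb1 R]_x h (x, t))%E,
     measurable_fun (setT : set mR) (fun x => \int[leb1 R]_(t in section a) h (x, t))%E &
     measurable_fun (section a : set mR) (fun t => \int[leb1 R]_x h (x, t))%E].
Proof.
move=> mh h0; pose g := h \_ (strip a).
have mg : measurable_fun (setT : set T2) g.
  exact: ((measurable_restrictT h (measurable_strip a)).1 mh).
have g0 z : (0 <= g z)%E.
  by rewrite /g patchE; case: ifPn => // zs; apply: h0; move: zs; rewrite inE.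
have FE : fubini_F (leb1 R) g = (fun x => \int[leb1 R]_(t in section a) h (x, t))%E.
  apply/funext => x; rewrite [RHS]integral_mkcond; apply: eq_integral => t _.
  by rewrite /g !patchE; congr (if _ then _ else _);
    apply/idP/idP; rewrite !inE /strip/section/= in_itv.
have GE : fubini_G (leb1 R) g = ((fun t => \int[leb1 R]_x h (x, t)) \_ (section a))%E.
  apply/funext => t; rewrite patchE; case: ifPn => ta.
    apply: eq_integral => x _; rewrite /g patchE mem_set//.
    by apply: strip_section; move: ta; rewrite inE.
  apply: integral0_eq => x _; rewrite /g patchE memNset// => xt.
  by move/negP: ta; apply; rewrite inE; move: xt; rewrite /section/strip/= in_itv.
have mF : measurable_fun (setT : set mR) (fubini_F (leb1 R) g).
  exact: measurable_fun_fubini_tonelli_F.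
have mG : measurable_fun (setT : set mR) (fubini_G (leb1 R) g).
  exact: measurable_fun_fubini_tonelli_G.
have e1 : (\int[leb2 R]_(z in strip a) h z = \int[leb1 R]_x fubini_F (leb1 R) g x)%E.
  by rewrite integral_mkcond; exact: fubini_tonelli1.
split.
- by rewrite e1 FE.
- rewrite e1 [RHS]integral_mkcond -GE; exact: fubini_tonelli.
- by rewrite -FE.
- by apply/measurable_restrictT; [exact: measurable_section|rewrite -GE].
Qed.

(** Measurability refers to the product sigma-algebra. Rounding the first coordinate to a multiple
    of 1 / (n + 1) leaves countably many functions of the second one, each measurable by continuity,
    and [phi] is the pointwise limit of these roundings. *)
Lemma continuous_measurable2 (phi : R * R -> R) : continuous phi ->
  measurable_fun (setT : set T2) phi.
Proof.
move=> cphi.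
pose r n (x : R) : R := (Num.floor (x * n.+1%:R))%:~R / n.+1%:R.
apply: (@measurable_fun_cvg _ _ _ (setT : set T2) (fun n z => phi (r n z.1, z.2))).
  move=> n _ Y mY; rewrite setTI.
  rewrite (_ : _ @^-1` Y = \bigcup_(k : int)
     ([set x : mR | Num.floor (x * n.+1%:R) = k] `*`
      ((fun t => phi (k%:~R / n.+1%:R, t)) @^-1` Y : set mR))).
    apply: countable_bigcupT_measurable => // k; apply: measurableX.
      rewrite (_ : [set x | _] = (fun x : R => x * n.+1%:R) @^-1` `[k%:~R, (k + 1)%:~R[%classic).
        have mh : measurable_fun (setT : set mR) (fun x : R => x * n.+1%:R).
          by apply: measurable_funM => //; exact: measurable_cst.
        by rewrite -[X in measurable X]setTI; apply: mh => //; exact: measurable_itv.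
      apply/seteqP; split => x /=; rewrite in_itv/= -floor_eq.
        by move=> /eqP.
      by move=> /eqP.
    have mk : measurable_fun (setT : set mR) (fun t => phi (k%:~R / n.+1%:R, t)).
      apply: continuous_measurable_fun => t.
      apply: (@continuous_comp _ _ _ (fun t : R => (k%:~R / n.+1%:R : R, t)) phi).
        by rewrite /prop_for /continuous_at; exact: (cvg_pair (cvg_cst _) cvg_id).
      exact: cphi.
    by rewrite -[X in measurable X]setTI; exact: mk.
  apply/seteqP; split => [z zY|z [k _ [<-]]] //=.
  by exists (Num.floor (z.1 * n.+1%:R)).
move=> [x t] _ /=.
have rx : r n x @[n --> \oo] --> x.
  apply/cvgrPdist_le => eps eps0; near=> n.
  have n0 : 0 < n.+1%:R :> R by [].
  apply: (@le_trans _ _ n.+1%:R^-1); last first.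
    by apply: ltW; near: n; exact: (near_infty_natSinv_lt (PosNum eps0)).
  have /andP[f1 f2] := floor_itv (x * n.+1%:R).
  rewrite -(ler_pM2r n0) mulVf ?gt_eqF// -{1}(gtr0_norm n0) -normrM mulrBl /r mulfVK ?gt_eqF//.
  by move: f2; rewrite rmorphD/= => f2; rewrite ler_norml; apply/andP; split; lra.
apply: (@cvg_comp _ _ _ (fun n => (r n x, t)) phi \oo (nbhs (x, t))); last exact: cphi.
exact: (cvg_pair rx (cvg_cst t)).
Unshelve. all: by end_near. Qed.

End strip_integrals.

(** * Passage from test functions to Sobolev functions *)

Section weighted_limits.
Context d (T : measurableType d) (R : realType) (mu : {measure set T -> \bar R}).
Variables (D : set T) (mD : measurable D).
Implicit Types (w u v : T -> R).

Definition wsq w u : \bar R := (\int[mu]_(x in D) (w x * u x ^+ 2)%:E)%E.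

Lemma wsq_ge0 w u : (forall x, D x -> 0 <= w x) -> (0 <= wsq w u)%E.
Proof. by move=> w0; apply: integral_ge0 => x Dx; rewrite lee_fin mulr_ge0 ?w0 ?sqr_ge0. Qed.

(** Pointwise, (1 + e) v^2 + (1 + 1/e) (v - u)^2 - u^2 = (e v + (v - u))^2 / e. The bound [W] is
    spent on the error term only. *)
Lemma wsq_young w u v (W e : R) : measurable_fun D w ->
  (forall x, D x -> 0 <= w x <= W) -> measurable_fun D u -> measurable_fun D v -> 0 < e ->
  (wsq w u <= (1 + e)%:E * wsq w v + ((1 + e^-1) * W)%:E * sqL2norm mu D (v \- u)%R)%E.
Proof.
move=> mw wW m_u mv e0.
have w0 x : D x -> 0 <= w x by move=> /wW/andP[].
have e1 : 0 <= 1 + e by rewrite addr_ge0// ltW.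
have W0 : forall x, D x -> 0 <= W by move=> x /wW/andP[]; exact: le_trans.
have eV : 0 <= 1 + e^-1 by rewrite addr_ge0// invr_ge0 ltW.
have msq (g : T -> R) : measurable_fun D g -> measurable_fun D (fun x => (g x ^+ 2)%:E).
  by move=> mg; apply/measurable_EFinP; exact: measurable_funX.
have mwq (g : T -> R) : measurable_fun D g -> measurable_fun D (fun x => (w x * g x ^+ 2)%:E).
  by move=> mg; apply/measurable_EFinP/measurable_funM => //; exact: measurable_funX.
have mvu : measurable_fun D (v \- u) by exact: measurable_funB.
have [D0|/set0P[x0 Dx0]] := eqVneq D set0.
  by rewrite /wsq /sqL2norm D0 !integral_set0 !mule0 adde0.
have {}W0 : 0 <= W by exact: (W0 x0).
rewrite /wsq /sqL2norm -ge0_integralZl_EFin//; first last.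
- exact: mwq.
- by move=> x Dx; rewrite lee_fin mulr_ge0 ?w0 ?sqr_ge0.
rewrite -ge0_integralZl_EFin//; first last.
- by rewrite mulr_ge0.
- exact: msq.
- by move=> x Dx; rewrite lee_fin sqr_ge0.
rewrite -ge0_integralD//; first last.
- by apply: emeasurable_funM => //; exact: msq.
- by move=> x Dx; apply: mule_ge0; rewrite lee_fin ?sqr_ge0// mulr_ge0.
- by apply: emeasurable_funM => //; exact: mwq.
- by move=> x Dx; apply: mule_ge0; rewrite lee_fin// mulr_ge0 ?w0 ?sqr_ge0.
apply: ge0_le_integral => //.
- by move=> x Dx; rewrite lee_fin mulr_ge0 ?w0 ?sqr_ge0.
- exact: mwq.
- apply: emeasurable_funD; apply: emeasurable_funM => //; [exact: mwq|exact: msq].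
move=> x Dx; rewrite -!EFinM -EFinD lee_fin /=.
have /andP[wx0 wxW] := wW x Dx.
apply: (@le_trans _ _ (w x * ((1 + e) * v x ^+ 2 + (1 + e^-1) * (v x - u x) ^+ 2))).
  rewrite ler_wpM2l// -subr_ge0.
  rewrite (_ : _ - _ = (e * v x + (v x - u x)) ^+ 2 / e).
    by rewrite divr_ge0 ?sqr_ge0// ltW.
  by field; rewrite gt_eqF.
rewrite mulrDr [X in X + _]mulrCA lerD2l mulrA ler_wpM2r ?sqr_ge0// mulrC.
by rewrite ler_wpM2l.
Qed.

(** [C] may blow up as [e] tends to 0, so [e] is fixed first and [n] is chosen after it. *)
Lemma le_of_young (X Y : \bar R) (en : nat -> \bar R) : (0 <= Y)%E ->
  (forall n, (0 <= en n)%E) -> en n @[n --> \oo] --> 0%E ->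
  (forall e : R, 0 < e -> exists2 C : R, 0 <= C &
     forall n, (X <= ((1 + e) ^+ 2)%:E * Y + C%:E * en n)%E) -> (X <= Y)%E.
Proof.
move=> Y0 en0 cen h.
case: Y Y0 h => [y| |//] Y0 h; last by rewrite leey.
move: Y0; rewrite lee_fin => y0.
apply/lee_addgt0Pr => eps eps0.
(* For [e <= 1] one has (1 + e)^2 y <= y + 3 e y, and this choice gives 3 e y <= eps / 2. The other
   half of [eps] is left for [C * en n]. *)
pose e := Num.min 1 (eps / (2 * (3 * y + 1))).
have k0 : 0 < 2 * (3 * y + 1) by rewrite mulr_gt0// ltr_wpDl// mulr_ge0.
have e0 : 0 < e by rewrite lt_min ltr01 divr_gt0.
have [C C0 hC] := h e e0.
have d0 : 0 < eps / (2 * (C + 1)) by rewrite divr_gt0// mulr_gt0// ltr_wpDl.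
have [n hn] : exists n, (en n <= (eps / (2 * (C + 1)))%:E)%E.
  have : \forall n \near \oo, (en n < (eps / (2 * (C + 1)))%:E)%E.
    have /fine_cvgP[fin cv] := cen.
    near=> n; have fn : en n \is a fin_num by near: n.
    by rewrite -(fineK fn) lte_fin; near: n; exact: (cvgr_lt _ cv).
  by move=> [N _ hN]; exists N; apply/ltW/(hN N)/leqnn.
apply: (le_trans (hC n)).
apply: (@le_trans _ _ (((1 + e) ^+ 2)%:E * y%:E + C%:E * (eps / (2 * (C + 1)))%:E)%E).
  by rewrite leeD2l// lee_wpmul2l.
rewrite -!EFinM -!EFinD lee_fin.
have e1 : e <= 1 by rewrite ge_min lexx.
have ey : e * (3 * y) <= eps / 2.
  apply: (@le_trans _ _ (eps / (2 * (3 * y + 1)) * (3 * y + 1))); last first.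
    rewrite le_eqVlt; apply/orP; left; apply/eqP; field.
    by move: k0; rewrite pmulr_rgt0// => /lt0r_neq0.
  rewrite ler_pM ?(ltW e0) ?mulr_ge0//; first by rewrite ge_min lexx orbT.
  by rewrite lerDl.
have Ce : C * (eps / (2 * (C + 1))) <= eps / 2.
  rewrite mulrA ler_pdivrMr ?mulr_gt0// ?ltr_wpDl//.
  rewrite (_ : eps / 2 * (2 * (C + 1)) = C * eps + eps); last by field.
  by rewrite lerDl ltW.
have ee : e ^+ 2 * y <= e * y.
  by rewrite ler_wpM2r// expr2 ler_piMr// ltW.
rewrite (_ : (1 + e) ^+ 2 * y = y + 2 * (e * y) + e ^+ 2 * y); last by ring.
by move: ey Ce ee; rewrite [e * (3 * y)]mulrCA; move: (C * _) (e * y) (e ^+ 2 * y) => p q r; lra.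
Unshelve. all: by end_near. Qed.

Lemma young_sum (Y2 Y3 eu eg : \bar R) (k c : R) : 0 <= k -> 0 <= c ->
  (0 <= Y2)%E -> (0 <= Y3)%E -> (0 <= eu)%E -> (0 <= eg)%E ->
  (k%:E * ((k%:E * Y2 + c%:E * eg) + (k%:E * Y3 + c%:E * eu)) + c%:E * eu <=
   (k ^+ 2)%:E * (Y2 + Y3) + (c + k * c)%:E * (eu + eg))%E.
Proof.
move=> k0 c0 Y20 Y30 eu0 eg0.
rewrite addeACA -(ge0_muleDr k%:E Y20 Y30) -(ge0_muleDr c%:E eg0 eu0).
rewrite (@ge0_muleDr _ k%:E (k%:E * (Y2 + Y3))%E (c%:E * (eg + eu))%E); last 2 first.
- by rewrite mule_ge0 ?adde_ge0.
- by rewrite mule_ge0 ?adde_ge0.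
rewrite !muleA -!EFinM -expr2 -addeA leeD2l// EFinD ge0_muleDl ?lee_fin ?mulr_ge0//.
by rewrite addeC (addeC eu eg) leeD2r// lee_wpmul2l ?lee_fin// leeDr.
Qed.

(** Young's inequality is used in both directions, from [u] to [un n] on the left and from the
    approximants back to [g] and [u] on the right; hence the square of [1 + e]. *)
Lemma wsq_limit (w1 w2 w3 u g : T -> R) (un gn : nat -> T -> R) (W : R) :
  measurable_fun D w1 -> measurable_fun D w2 -> measurable_fun D w3 ->
  (forall x, D x -> 0 <= w1 x <= W) -> (forall x, D x -> 0 <= w2 x <= W) ->
  (forall x, D x -> 0 <= w3 x <= W) -> 0 <= W ->
  measurable_fun D u -> measurable_fun D g ->
  (forall n, measurable_fun D (un n)) -> (forall n, measurable_fun D (gn n)) ->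
  sqL2norm mu D (un n \- u) @[n --> \oo] --> 0%E ->
  sqL2norm mu D (gn n \- g) @[n --> \oo] --> 0%E ->
  (forall n, (wsq w1 (un n) <= wsq w2 (gn n) + wsq w3 (un n))%E) ->
  (wsq w1 u <= wsq w2 g + wsq w3 u)%E.
Proof.
move=> mw1 mw2 mw3 b1 b2 b3 W0 m_u mg mun mgn cu cg h.
have p w : (forall x, D x -> 0 <= w x <= W) -> forall x, D x -> 0 <= w x.
  by move=> b x /b/andP[].
have s0 v : (0 <= sqL2norm mu D v)%E.
  by apply: integral_ge0 => x _; rewrite lee_fin sqr_ge0.
have sym v v' : sqL2norm mu D (v \- v') = sqL2norm mu D (v' \- v).
  by apply: eq_integral => x _ /=; rewrite -sqrrN opprB.
apply: (@le_of_young _ _ (fun n => sqL2norm mu D (un n \- u)%R + sqL2norm mu D (gn n \- g)%R)%E).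
- by rewrite adde_ge0// wsq_ge0//; exact: p.
- by move=> n; rewrite adde_ge0.
- by rewrite -(adde0 0%E); apply: cvgeD.
move=> e e0; pose c := (1 + e^-1) * W.
have c0 : 0 <= c by rewrite mulr_ge0// addr_ge0// invr_ge0 ltW.
have e1 : 0 <= 1 + e by rewrite addr_ge0// ltW.
exists (c + (1 + e) * c); first by rewrite addr_ge0// mulr_ge0.
move=> n.
set eu := sqL2norm _ _ (un n \- u); set eg := sqL2norm _ _ (gn n \- g).
have y1 := wsq_young mw1 b1 m_u (mun n) e0.
have y2 := wsq_young mw2 b2 (mgn n) mg e0.
have y3 := wsq_young mw3 b3 (mun n) m_u e0.
rewrite sym -/eg -/c in y2; rewrite sym -/eu -/c in y3; rewrite -/eu -/c in y1.
apply: (le_trans y1).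
apply: (@le_trans _ _ ((1 + e)%:E * (((1 + e)%:E * wsq w2 g + c%:E * eg) +
   ((1 + e)%:E * wsq w3 u + c%:E * eu)) + c%:E * eu)%E).
  rewrite leeD2r// lee_wpmul2l ?lee_fin//.
  by apply: (le_trans (h n)); exact: leeD.
have q2 := wsq_ge0 g (p _ b2); have q3 := wsq_ge0 u (p _ b3).
have eu0 : (0 <= eu)%E by exact: s0.
have eg0 : (0 <= eg)%E by exact: s0.
exact: young_sum.
Qed.

End weighted_limits.

(** * The horizontal and transversal inequalities for test functions on the strip *)

Section strip_inequalities.
Context (R : realType).
Local Notation mR := (measurableTypeR R).
Local Notation T2 := (mR * mR)%type.
Implicit Types (phi : R * R -> R) (a : R).

Lemma measurable_test a phi : test_function (strip a) phi ->
  measurable_fun (setT : set T2) phi /\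
  (forall i, measurable_fun (setT : set T2) (D2 i phi)).
Proof.
move=> [sphi _]; split; first by apply: continuous_measurable2; exact: smooth_continuous.
by move=> i; apply: continuous_measurable2; apply: smooth_continuous; exact: smooth_derive.
Qed.

Lemma measurable_fst_fun a (k : R -> R) : measurable_fun (setT : set mR) k ->
  measurable_fun (strip a : set T2) (fun z => k z.1).
Proof. by move=> mk; apply: measurable_funTS; exact: (measurableT_comp mk measurable_fst). Qed.

Lemma D2_slice1 phi (x t : R) : D2 ord0 phi (x, t) = D1 tt (fun x => phi (x, t)) x.
Proof. by rewrite /D2 /D1 /basis2 eqxx derive_slice1. Qed.

Lemma D2_slice2 phi (x t : R) : D2 ord_max phi (x, t) = D1 tt (fun t => phi (x, t)) t.
Proof. by rewrite /D2 /D1 /basis2 derive_slice2. Qed.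

(** [hardy_average] on each horizontal line, integrated over the section. Compact support of [phi]
    gives one [N] for all lines. *)
Lemma hardy_strip a phi (B : set mR) (j0 j1 beta : R) : test_function (strip a) phi ->
  j0 <= j1 -> measurable B -> B `<=` `]j0, j1[%classic -> leb1 R B = beta%:E ->
  (wsq (leb2 R) (strip a) (fun z => beta * (8 * (1 + (j1 - j0) / 2) ^+ 2)^-1 / (1 + `|z.1 - (j0 + j1) / 2| ^+ 2))%R phi <=
   wsq (leb2 R) (strip a) (fun=> beta)%R (D2 ord0 phi) +
   wsq (leb2 R) (strip a) (fun z => \1_B z.1)%R phi)%E.
Proof.
move=> tphi j01 mB BJ BE; set k := (8 * _)^-1; have [mphi mD] := measurable_test tphi.
have sphi : smooth phi by case: tphi.
have [N N0 phiN] := compact_slice1 tphi.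
have mS := measurable_section a.
have beta0 : 0 <= beta by rewrite -lee_fin -BE.
have k0 : 0 <= k by rewrite invr_ge0 mulr_ge0// sqr_ge0.
set x0 := (j0 + j1) / 2.
have mden : measurable_fun (setT : set mR) (fun x : R => (1 + `|x - x0| ^+ 2)^-1).
  apply: continuous_measurable_fun => x.
  apply: cvgV; first by rewrite gt_eqF// ltr_pwDl// sqr_ge0.
  apply: cvgD; first exact: cvg_cst.
  apply: (@continuous_comp _ _ _ (fun x : R => `|x - x0|) (fun y => y ^+ 2));
    last exact: exprn_continuous.
  by apply: cvg_norm; apply: cvgB; [exact: cvg_id|exact: cvg_cst].
have m1B : measurable_fun (setT : set mR) (\1_B : mR -> R) by exact: measurable_indic.
have mphi2 : measurable_fun (strip a : set T2) (fun z => phi z ^+ 2).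
  by apply: measurable_funX; exact: measurable_funTS.
have mw (c : R -> R) : measurable_fun (setT : set mR) c ->
    measurable_fun (strip a : set T2) (fun z => (c z.1 * phi z ^+ 2)%:E).
  by move=> mc; apply/measurable_EFinP/measurable_funM => //; exact: measurable_fst_fun.
have m1 := mw _ (measurable_funM (@measurable_cst _ _ mR R setT (beta * k)) mden).
have m2 : measurable_fun (strip a : set T2) (fun z => (beta * D2 ord0 phi z ^+ 2)%:E).
  apply/measurable_EFinP/measurable_funM => //.
  by apply: measurable_funX; apply: measurable_funTS; exact: mD.
have m3 := mw _ m1B.
have i0 z : 0 <= (\1_B z : R) by rewrite indicE.
have [|_ e1 _ _] := strip_tonelli m1.
  by move=> z _; rewrite lee_fin mulr_ge0 ?sqr_ge0// mulr_ge0 ?mulr_ge0// invr_ge0 addr_ge0// sqr_ge0.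
have [|_ e2 _ mm2] := strip_tonelli m2.
  by move=> z _; rewrite lee_fin mulr_ge0 ?sqr_ge0.
have [|_ e3 _ mm3] := strip_tonelli m3.
  by move=> z _; rewrite lee_fin mulr_ge0 ?sqr_ge0.
rewrite /wsq e1 e2 e3.
have [|_ _ _ mm1] := strip_tonelli m1.
  by move=> z _; rewrite lee_fin mulr_ge0 ?sqr_ge0// mulr_ge0 ?mulr_ge0// invr_ge0 addr_ge0// sqr_ge0.
have g2 t : (0 <= \int[leb1 R]_x (beta * D2 ord0 phi (x, t) ^+ 2)%:E)%E.
  by apply: integral_ge0 => x _; rewrite lee_fin mulr_ge0 ?sqr_ge0.
have g3 t : (0 <= \int[leb1 R]_x (\1_B x * phi (x, t) ^+ 2)%:E)%E.
  by apply: integral_ge0 => x _; rewrite lee_fin mulr_ge0 ?sqr_ge0.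
rewrite -ge0_integralD//.
apply: ge0_le_integral => //.
- move=> t _; apply: integral_ge0 => x _.
  by rewrite lee_fin mulr_ge0 ?sqr_ge0// mulr_ge0 ?mulr_ge0// invr_ge0 addr_ge0// sqr_ge0.
- exact: emeasurable_funD.
move=> t ta /=.
pose w x := phi (x, t).
have sw : smooth w by exact: smooth_slice1.
have cw := smooth_continuous sw.
have mw2 : measurable_fun (setT : set mR) (fun x => w x ^+ 2).
  by apply: measurable_funX; exact: continuous_measurable_fun.
have mDw : measurable_fun (setT : set mR) (fun x => D1 tt w x ^+ 2).
  by apply: measurable_funX; apply: continuous_measurable_fun; exact/smooth_continuous/smooth_derive.
have := @hardy_average R w N B j0 j1 sw _ j01 mB BJ.
rewrite BE -/k -/x0 => /(_ _)/le_trans H.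
have -> : (\int[leb1 R]_x (beta * k * (1 + `|x - x0| ^+ 2)^-1 * phi (x, t) ^+ 2)%:E =
   beta%:E * (k%:E * \int[leb1 R]_x (w x ^+ 2 / (1 + `|x - x0| ^+ 2))%:E))%E.
  rewrite muleA -EFinM -ge0_integralZl_EFin//.
  - by apply: eq_integral => x _; rewrite -EFinM; congr EFin; rewrite /w -mulrA [_^-1 * _]mulrC.
  - by move=> x _; rewrite lee_fin divr_ge0 ?addr_ge0 ?sqr_ge0.
  - by apply/measurable_EFinP/measurable_funM.
  - by rewrite mulr_ge0.
apply: H; first by move=> x Nx; exact: phiN.
have -> : (\int[leb1 R]_x (beta * D2 ord0 phi (x, t) ^+ 2)%:E =
    beta%:E * \int[leb1 R]_x (D1 tt w x ^+ 2)%:E)%E.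
  have mDw' : measurable_fun (setT : set mR) (fun x => (D1 tt w x ^+ 2)%:E).
    exact/measurable_EFinP.
  rewrite -(@ge0_integralZl_EFin _ _ _ (leb1 R) setT measurableT
    (fun x => (D1 tt w x ^+ 2)%:E) _ mDw' beta beta0).
    by apply: eq_integral => x _; rewrite -EFinM D2_slice1.
  by move=> x _; rewrite lee_fin sqr_ge0.
rewrite leeD2l//.
rewrite integral_mkcond le_eqVlt; apply/orP; left; apply/eqP; apply: eq_integral => x _.
by rewrite patchE indicE; case: ifP => _; rewrite ?mul1r ?mul0r.
Qed.

Section fibre.
Context (a m M L : R) (f : R * R -> R).
Hypotheses (a0 : 0 < a) (m0 : 0 < m) (mf : measurable_fun (strip a : set T2) f).
Hypotheses (fm : forall z, strip a z -> m <= f z) (fM : forall z, strip a z -> f z <= M).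
Hypothesis (fL : forall x s t : R, section a s -> section a t ->
  `|f (x, t) - f (x, s)| <= L * `|t - s|).
Context (eta : R) (B : set (measurableTypeR R)).
Hypotheses (eta0 : 0 <= eta) (mB : measurable B).
Hypotheses (etaB : forall x, B x -> eta <= muK a f x).
Hypothesis (muK0 : {ae leb1 R, forall x, 0 <= muK a f x}).

Let E10 : 0 <= E1 a.
Proof. by rewrite /E1 sqr_ge0. Qed.

Let f0 z : strip a z -> 0 <= f z.
Proof. by move=> /fm; apply: le_trans; exact: ltW. Qed.

Let i0 x : 0 <= (\1_B x : R).
Proof. by rewrite indicE. Qed.

(** On almost every fibre [muK] dominates [eta 1_B]: by [etaB] on [B], by non-negativity elsewhere.
    The slice of [phi] is then a competitor for [muK]. *)
Lemma fibre_strip phi : test_function (strip a) phi ->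
  (wsq (leb2 R) (strip a) (fun z => (E1 a + eta * \1_B z.1) * f z)%R phi <=
   wsq (leb2 R) (strip a) f (D2 ord_max phi))%E.
Proof.
move=> tphi; have [mphi mD] := measurable_test tphi.
have mS := measurable_section a.
have m1B : measurable_fun (setT : set mR) (\1_B : mR -> R) by exact: measurable_indic.
have mc : measurable_fun (setT : set mR) (fun x => E1 a + eta * \1_B x).
  by apply: measurable_funD => //; apply: measurable_funM.
have mc1 : measurable_fun (strip a : set T2) (fun z => E1 a + eta * \1_B z.1).
  exact: (@measurable_fst_fun a (fun x => E1 a + eta * \1_B x) mc).
have c0 x : 0 <= E1 a + eta * \1_B x by rewrite addr_ge0// mulr_ge0.
have m1 : measurable_fun (strip a : set T2) (fun z => ((E1 a + eta * \1_B z.1) * f z * phi z ^+ 2)%:E).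
  apply/measurable_EFinP; apply: measurable_funM.
    exact: (measurable_funM mc1 mf).
  by apply: measurable_funX; exact: measurable_funTS.
have m2 : measurable_fun (strip a : set T2) (fun z => (f z * D2 ord_max phi z ^+ 2)%:E).
  apply/measurable_EFinP; apply: measurable_funM => //.
  by apply: measurable_funX; apply: measurable_funTS; exact: mD.
have n1 z : strip a z -> (0 <= ((E1 a + eta * \1_B z.1) * f z * phi z ^+ 2)%:E)%E.
  by move=> za; rewrite lee_fin mulr_ge0 ?sqr_ge0// mulr_ge0 ?c0 ?f0.
have n2 z : strip a z -> (0 <= (f z * D2 ord_max phi z ^+ 2)%:E)%E.
  by move=> za; rewrite lee_fin mulr_ge0 ?f0 ?sqr_ge0.
have [e1 _ mm1 _] := strip_tonelli m1 n1.
have [e2 _ mm2 _] := strip_tonelli m2 n2.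
rewrite /wsq e1 e2; apply: ae_ge0_le_integral => //.
- by move=> x _; apply: integral_ge0 => t ta; apply: n1; exact: strip_section.
- by move=> x _; apply: integral_ge0 => t ta; apply: n2; exact: strip_section.
apply: (@filterS _ _ (ae_filter_ringOfSetsType (leb1 R)) _ _ _ muK0) => x mux _ /=.
have mw : measurable_fun (section a : set mR) (fun t => (phi (x, t) ^+ 2 * f (x, t))%:E).
  apply/measurable_EFinP; apply: measurable_funM; last exact: measurable_slice2.
  by apply: measurable_funX; apply: measurable_funTS; exact: (measurable_fun_pair2 x mphi).
have w0 t : section a t -> (0 <= (phi (x, t) ^+ 2 * f (x, t))%:E)%E.
  by move=> ta; rewrite lee_fin mulr_ge0 ?sqr_ge0// f0//; exact: strip_section.
have -> : (\int[leb1 R]_(t in section a) ((E1 a + eta * \1_B x) * f (x, t) * phi (x, t) ^+ 2)%:E =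
  (E1 a + eta * \1_B x)%:E * \int[leb1 R]_(t in section a) (phi (x, t) ^+ 2 * f (x, t))%:E)%E.
  rewrite -(@ge0_integralZl_EFin _ _ _ (leb1 R) _ mS _ w0 mw _ (c0 x)).
  by apply: eq_integral => t _; rewrite -EFinM -mulrA [f _ * _]mulrC.
have -> : (\int[leb1 R]_(t in section a) (f (x, t) * D2 ord_max phi (x, t) ^+ 2)%:E =
    \int[leb1 R]_(t in section a) (D1 tt (fun t => phi (x, t)) t ^+ 2 * f (x, t))%:E)%E.
  by apply: eq_integral => t _; rewrite D2_slice2 mulrC.
apply: le_trans (muK_test a0 m0 mf fm fM x (test_slice2 x tphi)).
apply: lee_wpmul2r; first exact: integral_ge0.
rewrite lee_fin addrC lerD2r indicE; have [/set_mem xB|_] := boolP (x \in B).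
  by rewrite mulr1 etaB.
by rewrite mulr0.
Qed.

End fibre.
End strip_inequalities.

Section weights.
Context d (T : measurableType d) (R : realType) (mu : {measure set T -> \bar R}).
Variables (D : set T) (mD : measurable D).
Implicit Types (w u : T -> R).

Lemma measurable_wsq w u : measurable_fun D w -> measurable_fun D u ->
  measurable_fun D (fun x => (w x * u x ^+ 2)%:E).
Proof. by move=> mw m_u; apply/measurable_EFinP/measurable_funM => //; exact: measurable_funX. Qed.

Lemma wsq_le w w' u : measurable_fun D w -> measurable_fun D w' -> measurable_fun D u ->
  (forall x, D x -> 0 <= w x) -> (forall x, D x -> w x <= w' x) ->
  (wsq mu D w u <= wsq mu D w' u)%E.
Proof.
move=> mw mw' m_u w0 ww'; apply: ge0_le_integral => //.
- by move=> x Dx; rewrite lee_fin mulr_ge0 ?w0 ?sqr_ge0.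
- exact: measurable_wsq.
- exact: measurable_wsq.
- by move=> x Dx; rewrite lee_fin ler_wpM2r ?sqr_ge0 ?ww'.
Qed.

Lemma wsqZ (c : R) w u : measurable_fun D w -> measurable_fun D u ->
  (forall x, D x -> 0 <= w x) -> 0 <= c ->
  wsq mu D (fun x => c * w x) u = (c%:E * wsq mu D w u)%E.
Proof.
move=> mw m_u w0 c0.
have w1 x : D x -> (0 <= (w x * u x ^+ 2)%:E)%E.
  by move=> Dx; rewrite lee_fin mulr_ge0 ?w0 ?sqr_ge0.
rewrite /wsq -(@ge0_integralZl_EFin _ _ _ mu _ mD _ w1 (measurable_wsq mw m_u) _ c0).
by apply: eq_integral => x _; rewrite -EFinM; congr EFin; rewrite -mulrA.
Qed.

Lemma wsq_sqmod w (psi : T -> R[i]) : measurable_fun D w ->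
  measurable_fun D (fun x => complex.Re (psi x)) ->
  measurable_fun D (fun x => complex.Im (psi x)) -> (forall x, D x -> 0 <= w x) ->
  (\int[mu]_(x in D) (w x * sqmod (psi x))%:E =
   wsq mu D w (fun x => complex.Re (psi x)) + wsq mu D w (fun x => complex.Im (psi x)))%E.
Proof.
move=> mw mr mi w0; rewrite /wsq -ge0_integralD//.
- by apply: eq_integral => x _; rewrite -EFinD -mulrDr.
- by move=> x Dx; rewrite lee_fin mulr_ge0 ?w0 ?sqr_ge0.
- exact: measurable_wsq.
- by move=> x Dx; rewrite lee_fin mulr_ge0 ?w0 ?sqr_ge0.
- exact: measurable_wsq.
Qed.

End weights.

(** * The Hardy constant and the inequalities for Sobolev functions *)

Section main_inequalities.
Context (R : realType).
Local Notation mR := (measurableTypeR R).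
Local Notation T2 := (mR * mR)%type.

Lemma measurable_level_set (mu : R -> R) (j0 j1 eta : R) : measurable_fun (setT : set mR) mu ->
  measurable (`]j0, j1[%classic `&` [set x | eta <= mu x] : set mR).
Proof.
move=> mmu; apply: measurableI; first exact: measurable_itv.
rewrite (_ : [set x | _] = mu @^-1` `[eta, +oo[%classic).
  by rewrite -[X in measurable X]setTI; apply: mmu => //; exact: measurable_itv.
by apply/seteqP; split => x /=; rewrite in_itv/= andbT.
Qed.

(** Otherwise the sets where [mu >= 1 / (n + 1)] in the interval would all be null, and so would
    their union, on which [mu > 0]. *)
Lemma positive_level_set (mu : R -> R) (j0 j1 : R) : measurable_fun (setT : set mR) mu ->
  {ae leb1 R, forall x, 0 <= mu x} ->
  ~ {ae leb1 R, forall x, j0 < x < j1 -> mu x = 0} ->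
  exists n, (0 < leb1 R (`]j0, j1[%classic `&` [set x | (n.+1%:R^-1 <= mu x)%R]))%E.
Proof.
move=> mmu mu0 muN; apply: contrapT => /forallNP h; apply: muN.
pose B n : set mR := `]j0, j1[%classic `&` [set x | n.+1%:R^-1 <= mu x].
have mB n : measurable (B n).
  exact: measurable_level_set.
have B0 n : leb1 R (B n) = 0%E.
  by apply/eqP; rewrite eq_le measure_ge0 andbT leNgt; apply/negP; exact: h.
have nB : (leb1 R).-negligible (\bigcup_n B n).
  apply: negligible_bigcup => n; exists (B n); split => //; exact: B0.
have : (leb1 R).-negligible (~` [set x | 0 <= mu x] `|` \bigcup_n B n).
  exact: negligibleU.
apply: negligibleS => x /= hx; apply: contrapT => /not_orP[/contrapT mux hB].
apply: hx => jx; apply/eqP; rewrite eq_le mux andbT leNgt; apply/negP => mu_gt0.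
apply: hB; have [N _ hN] := near_infty_natSinv_lt (PosNum mu_gt0).
exists N => //; split; first by rewrite /= in_itv.
by apply/ltW; exact: (hN N (leqnn N)).
Qed.

(** A null set times a line is null since 0 times [+oo] is 0. *)
Lemma ae_fst (P : R -> Prop) : {ae leb1 R, forall x, P x} -> {ae leb2 R, forall z, P z.1}.
Proof.
move=> [N [mN N0 PN]]; exists (N `*` [set: mR]); split.
- exact: measurableX.
- have := @product_measure1E _ _ _ _ R (leb1 R) (leb1 R) N setT mN measurableT.
  move=> e; apply: (eq_trans e); apply: (eq_trans (congr1 (fun y => y * _)%E N0)); exact: mul0e.
- by move=> z /= /PN.
Qed.

Context (a m M L : R) (f : R * R -> R).
Hypotheses (a0 : 0 < a) (m0 : 0 < m) (mf : measurable_fun (strip a : set T2) f).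
Hypotheses (fm : forall z, strip a z -> m <= f z) (fM : forall z, strip a z -> f z <= M).
Hypothesis (fL : forall x s t : R, section a s -> section a t ->
  `|f (x, t) - f (x, s)| <= L * `|t - s|).
Context (eta : R) (B : set (measurableTypeR R)) (j0 j1 beta : R).
Hypotheses (eta0 : 0 < eta) (mB : measurable B).
Hypotheses (etaB : forall x, B x -> eta <= muK a f x).
Hypothesis (muK0 : {ae leb1 R, forall x, 0 <= muK a f x}).
Hypotheses (j01 : j0 <= j1) (BJ : B `<=` `]j0, j1[%classic) (BE : leb1 R B = beta%:E).
Hypothesis (beta0 : 0 < beta).

Let delta (z : R * R) : R := `|z.1 - (j0 + j1) / 2|.
(** The factor by which [hardy_strip] is multiplied. It gives [tau * beta <= M^-1 <= f^-1] for the
    horizontal energy and [tau <= eta * m <= eta * f] for the term on [B]. The further division by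
    [M] in [hardy_constant] makes room for the weight [f] on the left. *)
Let tau : R := Num.min (M^-1 / beta) (eta * m).
Definition hardy_constant : R := tau * beta * (8 * (1 + (j1 - j0) / 2) ^+ 2)^-1 / M.
Let c := hardy_constant.

Let M0 : 0 < M.
Proof.
have z : strip a (0, 0) by apply: strip_section; exact: section0.
exact: lt_le_trans m0 (le_trans (fm z) (fM z)).
Qed.

Let tau0 : 0 < tau.
Proof. by rewrite /tau lt_min divr_gt0 ?invr_gt0// mulr_gt0. Qed.

Let k0 : 0 < (8 * (1 + (j1 - j0) / 2) ^+ 2)^-1.
Proof.
by rewrite invr_gt0 mulr_gt0// exprn_gt0// ltr_pwDl// divr_ge0// subr_ge0.
Qed.

Lemma hardy_constant_gt0 : 0 < hardy_constant.
Proof. by rewrite divr_gt0// mulr_gt0// mulr_gt0. Qed.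

Let f_gt0 z : strip a z -> 0 < f z.
Proof. by move=> /fm; exact: lt_le_trans. Qed.

Let i0 x : 0 <= (\1_B x : R).
Proof. by rewrite indicE. Qed.

Let i1 x : (\1_B x : R) <= 1.
Proof. by rewrite indicE lern1 leq_b1. Qed.

(** Weights of the Hardy term, of the horizontal energy, of the bounded substitute for [muK * f],
    and of that substitute with [E1] added. *)
Let wH (z : R * R) : R := c * (f z / (1 + delta z ^+ 2)).
Let wV (z : R * R) : R := (f z)^-1.
Let wB (z : R * R) : R := eta * \1_B z.1 * f z.
Let wE (z : R * R) : R := (E1 a + eta * \1_B z.1) * f z.

Let mden : measurable_fun (strip a : set T2) (fun z => (1 + delta z ^+ 2)^-1).
Proof.
apply: measurable_funTS; apply: continuous_measurable2 => z.
apply: cvgV; first by rewrite gt_eqF// ltr_pwDl// sqr_ge0.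
apply: cvgD; first exact: cvg_cst.
apply: (@continuous_comp _ _ _ delta (fun y => y ^+ 2)); last exact: exprn_continuous.
by apply: cvg_norm; apply: cvgB; [exact: cvg_fst|exact: cvg_cst].
Qed.

Let mwH : measurable_fun (strip a : set T2) wH.
Proof. by apply: measurable_funM => //; exact: measurable_funM. Qed.

Let mwV : measurable_fun (strip a : set T2) wV.
Proof.
(* Cutting off at [m > 0] makes the inverse continuous on the whole line without changing it on the
   values of [f]. *)
have minv : measurable_fun (setT : set R) (fun y : R => (Num.max m y)^-1).
  apply: continuous_measurable_fun => y; apply: cvgV.
    by rewrite gt_eqF// lt_max m0.
  by apply: (@continuous_max _ _ (cst m) id y); [exact: cvg_cst|exact: cvg_id].
apply: eq_measurable_fun (measurableT_comp minv mf) => z; rewrite inE => za /=.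
by rewrite /wV max_r// fm.
Qed.

Let m1B : measurable_fun (strip a : set T2) (fun z => \1_B z.1 : R).
Proof. by apply: (@measurable_fst_fun _ a (\1_B : R -> R)); exact: measurable_indic. Qed.

Let mwB : measurable_fun (strip a : set T2) wB.
Proof. by apply: measurable_funM => //; exact: measurable_funM. Qed.

Let mwE : measurable_fun (strip a : set T2) wE.
Proof.
by apply: measurable_funM => //; apply: measurable_funD => //; exact: measurable_funM.
Qed.

Let c0 : 0 < c. Proof. exact: hardy_constant_gt0. Qed.

Let den1 z : (1 + delta z ^+ 2)^-1 <= 1.
Proof. by rewrite invf_le1 ?lerDl ?sqr_ge0// ltr_pwDl// sqr_ge0. Qed.

Let den0 z : 0 <= (1 + delta z ^+ 2)^-1.
Proof. by rewrite invr_ge0 addr_ge0// sqr_ge0. Qed.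

Let wH0 z : strip a z -> 0 <= wH z.
Proof. by move=> za; rewrite mulr_ge0 ?(ltW c0)// mulr_ge0// ltW// f_gt0. Qed.

Let wV0 z : strip a z -> 0 <= wV z.
Proof. by move=> za; rewrite invr_ge0 ltW// f_gt0. Qed.

Let wB0 z : strip a z -> 0 <= wB z.
Proof. by move=> za; rewrite mulr_ge0 ?(ltW (f_gt0 za))// mulr_ge0// ltW. Qed.

Let E10 : 0 <= E1 a. Proof. by rewrite /E1 sqr_ge0. Qed.

Let wE0 z : strip a z -> 0 <= wE z.
Proof. by move=> za; rewrite mulr_ge0 ?(ltW (f_gt0 za))// addr_ge0// mulr_ge0// ltW. Qed.

Let f0 z : strip a z -> 0 <= f z. Proof. by move=> za; rewrite ltW// f_gt0. Qed.

(** A sum of non-negative bounds, hence one bound for all the weights, as [wsq_limit] requires. *)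
Let W : R := c * M + m^-1 + (E1 a + eta) * M + M.

Let mstrip := @measurable_strip R a.

Lemma hardy_test phi : test_function (strip a) phi ->
  (wsq (leb2 R) (strip a) wH phi <=
   wsq (leb2 R) (strip a) wV (D2 ord0 phi) + wsq (leb2 R) (strip a) wB phi)%E.
Proof.
move=> tphi; have [mphi mD] := measurable_test tphi.
have mphi' : measurable_fun (strip a : set T2) phi by exact: measurable_funTS.
have mD' : measurable_fun (strip a : set T2) (D2 ord0 phi).
  by apply: measurable_funTS; exact: mD.
have H := hardy_strip tphi j01 mB BJ BE.
set w1 : R * R -> R := fun z => beta * _ / (1 + _) in H.
have w10 z : 0 <= w1 z by rewrite mulr_ge0 ?den0// mulr_ge0 ?(ltW beta0)// ltW.
have mw1 : measurable_fun (strip a : set T2) w1.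
  by apply: measurable_funM => //; exact: mden.
apply: (@le_trans _ _ (wsq (leb2 R) (strip a) (fun z => tau * w1 z)%R phi)).
  apply: wsq_le => //; first by apply: measurable_funM.
  move=> z za; rewrite /wH /w1 /c /hardy_constant -/(delta z).
  rewrite [tau * (_ / _)]mulrA mulrA ler_wpM2r ?den0//.
  rewrite -!mulrA ler_pM2l// ler_pM2l// ler_piMr ?(ltW k0)//.
  by rewrite mulrC ler_pdivrMr// mul1r fM.
have be0 := ltW beta0; have ta0 := ltW tau0.
rewrite (wsqZ _ mstrip mw1 mphi' (fun z _ => w10 z) ta0).
apply: (@le_trans _ _ (tau%:E * wsq (leb2 R) (strip a) (fun=> beta)%R (D2 ord0 phi) +
    tau%:E * wsq (leb2 R) (strip a) (fun z => \1_B z.1)%R phi)%E).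
  rewrite -ge0_muleDr; [|exact: wsq_ge0..].
  by apply: lee_wpmul2l => //; rewrite lee_fin.
rewrite -(wsqZ _ mstrip (@measurable_cst _ _ T2 R _ beta) mD' (fun z _ => be0) ta0).
rewrite -(wsqZ _ mstrip m1B mphi' (fun z _ => i0 z.1) ta0).
apply: leeD; apply: wsq_le => //.
- by apply: measurable_funM.
- by move=> z _; rewrite mulr_ge0.
- move=> z za; rewrite /wV; apply: (@le_trans _ _ M^-1); last first.
    by rewrite lef_pV2 ?posrE ?fM// f_gt0.
  by rewrite -ler_pdivlMr// /tau ge_min lexx.
- by apply: measurable_funM.
- by move=> z _; rewrite mulr_ge0.
- move=> z za; rewrite /wB mulrAC ler_wpM2r//.
  apply: (@le_trans _ _ (eta * m)); first by rewrite /tau ge_min lexx orbT.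
  by rewrite ler_pM2l// fm.
Qed.

Let W1 : 0 <= c * M. Proof. by rewrite mulr_ge0// ltW. Qed.
Let W2 : 0 <= m^-1. Proof. by rewrite invr_ge0 ltW. Qed.
Let W3 : 0 <= (E1 a + eta) * M. Proof. by rewrite mulr_ge0 ?addr_ge0// ltW. Qed.
Let W4 : 0 <= M. Proof. exact: ltW. Qed.

Let sqW : 0 <= W. Proof. by rewrite /W; move: W1 W2 W3 W4; lra. Qed.

Let bH z : strip a z -> 0 <= wH z <= W.
Proof.
move=> za; rewrite wH0//= (@le_trans _ _ (c * M))//.
  rewrite ler_pM2l//; apply: (@le_trans _ _ (f z * 1)); last by rewrite mulr1 fM.
  by rewrite ler_wpM2l ?f0.
by rewrite /W; move: W1 W2 W3 W4; lra.
Qed.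

Let bV z : strip a z -> 0 <= wV z <= W.
Proof.
move=> za; rewrite wV0//= (@le_trans _ _ m^-1)//.
  by rewrite lef_pV2 ?posrE ?fm// f_gt0.
by rewrite /W; move: W1 W2 W3 W4; lra.
Qed.

Let bE z : strip a z -> 0 <= wE z <= W.
Proof.
move=> za; rewrite wE0//= (@le_trans _ _ ((E1 a + eta) * M))//.
  apply: ler_pM; rewrite ?f0 ?fM//; first by rewrite addr_ge0// mulr_ge0// ltW.
  by rewrite lerD2l ler_piMr ?i1// ltW.
by rewrite /W; move: W1 W2 W3 W4; lra.
Qed.

Let bB z : strip a z -> 0 <= wB z <= W.
Proof.
move=> za; rewrite wB0//=; have /andP[_] := bE za; apply: le_trans.
by rewrite /wB /wE ler_wpM2r ?f0// lerDr.
Qed.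

Let bf z : strip a z -> 0 <= f z <= W.
Proof.
move=> za; rewrite f0//= (le_trans (fM za))//.
by rewrite /W; move: W1 W2 W3 W4; lra.
Qed.

Lemma hardy_H10 u g :
  H10 (leb2 R) (strip a) (test_function (strip a)) (@D2 R) u g ->
  (wsq (leb2 R) (strip a) wH u <=
   wsq (leb2 R) (strip a) wV (g ord0) + wsq (leb2 R) (strip a) wB u)%E /\
  (wsq (leb2 R) (strip a) wE u <= wsq (leb2 R) (strip a) f (g ord_max))%E.
Proof.
move=> [[[m_u _] g2 _] [phi [tphi cu cg]]].
have mg i : measurable_fun (strip a : set T2) (g i) by have [] := g2 i.
have mphi n : measurable_fun (strip a : set T2) (phi n).
  by apply: measurable_funTS; exact: (measurable_test (tphi n)).1.
have mD n i : measurable_fun (strip a : set T2) (D2 i (phi n)).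
  by apply: measurable_funTS; exact: ((measurable_test (tphi n)).2 i).
split.
  apply: (wsq_limit mstrip mwH mwV mwB bH bV bB sqW m_u (mg ord0) mphi (fun n => mD n ord0) cu (cg ord0)).
  by move=> n; exact: hardy_test.
(* A third weight equal to 0 brings the transversal inequality into the shape of [wsq_limit]. *)
have -> : wsq (leb2 R) (strip a) f (g ord_max) =
    (wsq (leb2 R) (strip a) f (g ord_max) + wsq (leb2 R) (strip a) (fun=> 0)%R u)%E.
  by rewrite [X in (_ + X)%E]integral0_eq ?adde0// => z _; rewrite mul0r.
apply: (wsq_limit mstrip mwE mf (@measurable_cst _ _ T2 R _ 0) bE bf _ sqW m_u (mg ord_max)
  mphi (fun n => mD n ord_max) cu (cg ord_max)).
  by move=> z _; rewrite lexx sqW.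
move=> n; apply: (le_trans (fibre_strip a0 m0 mf fm fM (ltW eta0) mB etaB muK0 (tphi n))).
by rewrite leeDl// wsq_ge0.
Qed.

Let Bpart (psi : R * R -> R[i]) : \bar R :=
  (\int[leb2 R]_(z in strip a) (wB z * sqmod (psi z))%:E)%E.

Let mRe u g : H10_strip a u g ->
  measurable_fun (strip a : set T2) (fun z => complex.Re (u z)) /\
  forall i, measurable_fun (strip a : set T2) (fun z => complex.Re (g i z)).
Proof. by move=> [[[[m_u _] g2 _] _] _]; split => // i; have [] := g2 i. Qed.

Let mIm u g : H10_strip a u g ->
  measurable_fun (strip a : set T2) (fun z => complex.Im (u z)) /\
  forall i, measurable_fun (strip a : set T2) (fun z => complex.Im (g i z)).
Proof. by move=> [_ [[[m_u _] g2 _] _]]; split => // i; have [] := g2 i. Qed.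

Let msqmod (psi : R * R -> R[i]) :
  measurable_fun (strip a : set T2) (fun z => complex.Re (psi z)) ->
  measurable_fun (strip a : set T2) (fun z => complex.Im (psi z)) ->
  measurable_fun (strip a : set T2) (fun z => sqmod (psi z)).
Proof. by move=> mr mi; apply: measurable_funD; exact: measurable_funX. Qed.

(** The return from [eta 1_B] to [muK], made after the limit. Since [muK] is non-negative only
    almost everywhere, it is first replaced by its positive part, which leaves the integral
    unchanged and makes the comparison pointwise. *)
Lemma muK_integral_ge psi dpsi : H10_strip a psi dpsi ->
  (Bpart psi <= \int[leb2 R]_(z in strip a) (muK a f z.1 * sqmod (psi z) * f z)%:E)%E.
Proof.
move=> hp; have [mr _] := mRe hp; have [mi _] := mIm hp; have ms := msqmod mr mi.
have mmu := measurable_muK a0 m0 mf fm fM fL.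
have mmax : measurable_fun (setT : set mR) (fun x => Num.max 0 (muK a f x)).
  by apply: measurable_maxr.
have mmu2 := @measurable_fst_fun R a _ mmu; have mmax2 := @measurable_fst_fun R a _ mmax.
have mint (k : R * R -> R) : measurable_fun (strip a : set T2) k ->
    measurable_fun (strip a : set T2) (fun z => (k z * sqmod (psi z) * f z)%:E).
  by move=> mk; apply/measurable_EFinP; apply: measurable_funM => //; exact: measurable_funM.
rewrite (_ : (\int[leb2 R]_(z in strip a) (muK a f z.1 * sqmod (psi z) * f z)%:E =
    \int[leb2 R]_(z in strip a) (Num.max 0 (muK a f z.1) * sqmod (psi z) * f z)%:E)%E); last first.
  apply: ae_eq_integral => //; [exact: mint|exact: mint|].
  apply: (@filterS _ _ (ae_filter_ringOfSetsType (leb2 R)) _ _ _ (ae_fst muK0)) => z muz _ /=.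
  by rewrite max_r.
apply: ge0_le_integral => //.
- by move=> z za; rewrite lee_fin mulr_ge0 ?sqmod_ge0 ?wB0.
- by apply/measurable_EFinP; exact: measurable_funM.
- exact: mint.
move=> z za; rewrite lee_fin /wB mulrAC ler_wpM2r ?f0// ler_wpM2r ?sqmod_ge0//.
rewrite indicE; have [/set_mem zB|_] := boolP (z.1 \in B).
  by rewrite mulr1 le_max etaB ?orbT.
by rewrite mulr0 le_max lexx.
Qed.

(** Finiteness is what allows [E1 a * sqnormf] to be moved across the inequality in the extended
    reals. *)
Lemma sqnormf_fin_num psi dpsi : H10_strip a psi dpsi -> sqnormf a f psi \is a fin_num.
Proof.
move=> hp; have [mr _] := mRe hp; have [mi _] := mIm hp; have ms := msqmod mr mi.
have n0 : (0 <= sqnormf a f psi)%E.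
  by apply: integral_ge0 => z za; rewrite lee_fin mulr_ge0 ?sqmod_ge0 ?f0.
rewrite ge0_fin_numE//.
have -> : sqnormf a f psi = (wsq (leb2 R) (strip a) f (fun z => complex.Re (psi z)) +
    wsq (leb2 R) (strip a) f (fun z => complex.Im (psi z)))%E.
  rewrite -(wsq_sqmod _ mstrip mf mr mi (fun z za => f0 za)).
  by apply: eq_integral => z _; rewrite mulrC.
have fin u : measurable_fun (strip a : set T2) u -> (sqL2norm (leb2 R) (strip a) u < +oo)%E ->
    (wsq (leb2 R) (strip a) f u < +oo)%E.
  move=> m_u uoo; apply: (@le_lt_trans _ _ (wsq (leb2 R) (strip a) (fun=> M * 1)%R u)).
    by apply: wsq_le => // z za; rewrite ?f0 ?mulr1 ?fM.
  rewrite (@wsqZ _ _ _ (leb2 R) _ mstrip M (fun=> 1)%R)//.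
  apply: lte_mul_pinfty => //.
  rewrite (_ : wsq _ _ _ _ = sqL2norm (leb2 R) (strip a) u)//.
  by apply: eq_integral => z _; rewrite mul1r.
by move: hp => [[[[_ h1] _ _] _] [[[_ h2] _ _] _]]; rewrite lte_add_pinfty// fin.
Qed.

Lemma hardy_horizontal psi dpsi : H10_strip a psi dpsi ->
  (c%:E * \int[leb2 R]_(z in strip a) (sqmod (psi z) / (1 + delta z ^+ 2) * f z)%:E <=
   \int[leb2 R]_(z in strip a) ((f z)^-1 * sqmod (dpsi ord0 z))%:E + Bpart psi)%E.
Proof.
move=> hp; have [mr mr'] := mRe hp; have [mi mi'] := mIm hp; have ms := msqmod mr mi.
have mint : measurable_fun (strip a : set T2) (fun z => (sqmod (psi z) / (1 + delta z ^+ 2) * f z)%:E).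
  by apply/measurable_EFinP; apply: measurable_funM => //; exact: measurable_funM.
have int0 z : strip a z -> (0 <= (sqmod (psi z) / (1 + delta z ^+ 2) * f z)%:E)%E.
  by move=> za; rewrite lee_fin mulr_ge0 ?f0// mulr_ge0 ?sqmod_ge0 ?den0.
rewrite -(@ge0_integralZl_EFin _ _ _ (leb2 R) _ mstrip _ int0 mint _ (ltW c0)).
have -> : (\int[leb2 R]_(z in strip a) (c%:E * (sqmod (psi z) / (1 + delta z ^+ 2) * f z)%:E) =
    \int[leb2 R]_(z in strip a) (wH z * sqmod (psi z))%:E)%E.
  apply: eq_integral => z _; rewrite -EFinM; congr EFin; rewrite /wH.
  by rewrite -(mulrA c); congr (c * _); rewrite mulrC -!mulrA; congr (_ * _); rewrite mulrC.
rewrite /Bpart !wsq_sqmod// [leRHS]addeACA.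
by have [h1 h2] := hp; apply: leeD; [exact: (hardy_H10 h1).1|exact: (hardy_H10 h2).1].
Qed.

Lemma hardy_vertical psi dpsi : H10_strip a psi dpsi ->
  ((E1 a)%:E * sqnormf a f psi + Bpart psi <=
   \int[leb2 R]_(z in strip a) (f z * sqmod (dpsi ord_max z))%:E)%E.
Proof.
move=> hp; have [mr mr'] := mRe hp; have [mi mi'] := mIm hp; have ms := msqmod mr mi.
have mint : measurable_fun (strip a : set T2) (fun z => (sqmod (psi z) * f z)%:E).
  by apply/measurable_EFinP; exact: measurable_funM.
have int0 z : strip a z -> (0 <= (sqmod (psi z) * f z)%:E)%E.
  by move=> za; rewrite lee_fin mulr_ge0 ?f0 ?sqmod_ge0.
rewrite -(@ge0_integralZl_EFin _ _ _ (leb2 R) _ mstrip _ int0 mint _ E10).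
rewrite /Bpart -ge0_integralD//; first last.
- by apply/measurable_EFinP; exact: measurable_funM.
- by move=> z za; rewrite lee_fin mulr_ge0 ?wB0 ?sqmod_ge0.
- by apply: emeasurable_funM => //; exact: measurable_cst.
- by move=> z za; rewrite mule_ge0 ?int0// lee_fin.
have -> : (\int[leb2 R]_(z in strip a) ((E1 a)%:E * (sqmod (psi z) * f z)%:E +
      (wB z * sqmod (psi z))%:E) =
    \int[leb2 R]_(z in strip a) (wE z * sqmod (psi z))%:E)%E.
  apply: eq_integral => z _; rewrite -EFinM -EFinD; congr EFin.
  by rewrite /wE /wB; move: (\1_B _) => i; ring.
rewrite !wsq_sqmod//.
by have [h1 h2] := hp; apply: leeD; [exact: (hardy_H10 h1).2|exact: (hardy_H10 h2).2].
Qed.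

(** [Bpart psi] is an upper term in [hardy_horizontal] and a lower term in [hardy_vertical];
    chaining the two eliminates it without any subtraction. *)
Lemma hardy_form psi dpsi : H10_strip a psi dpsi ->
  (c%:E * \int[leb2 R]_(z in strip a) (sqmod (psi z) / (1 + delta z ^+ 2) * f z)%:E <=
   hK a f dpsi - (E1 a)%:E * sqnormf a f psi)%E.
Proof.
move=> hp; have [mr mr'] := mRe hp; have [mi mi'] := mIm hp.
have mD i := msqmod (mr' i) (mi' i).
have h1 := hardy_horizontal hp; have h2 := hardy_vertical hp.
have S := sqnormf_fin_num hp.
rewrite leeBrDr ?fin_numM//.
have -> : hK a f dpsi = (\int[leb2 R]_(z in strip a) ((f z)^-1 * sqmod (dpsi ord0 z))%:E +
    \int[leb2 R]_(z in strip a) (f z * sqmod (dpsi ord_max z))%:E)%E.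
  rewrite /hK -ge0_integralD//.
  - by move=> z za; rewrite lee_fin mulr_ge0 ?sqmod_ge0// (wV0 za).
  - by apply/measurable_EFinP; exact: measurable_funM.
  - by move=> z za; rewrite lee_fin mulr_ge0 ?f0 ?sqmod_ge0.
  - by apply/measurable_EFinP; exact: measurable_funM.
apply: (le_trans (leeD2r _ h1)); rewrite -addeA.
by apply: leeD2l; rewrite addeC.
Qed.

End main_inequalities.

(** * From the bound on the curvature to the Hardy inequality *)

Theorem theorem7p1 (R : realType) (a : R) (a_gt0 : 0 < a)
  (K : R * R -> R)
  (K_meas : measurable_fun (strip a) K)
  (K_bound : forall x, strip a x -> (`|K x|%:E <= normLoo a K)%E)
  (K_small : (normLoo a K * (a ^+ 2)%:E < (1 / 2)%:E)%E)
  (f : R * R -> R)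
  (f_jacobi : forall x1 : R,
     jacobi_solution a (fun t => K (x1, t)) (fun t => f (x1, t)))
  (j0 j1 : R) (J_nonempty : j0 < j1)
  (muK_ge0 : {ae leb1 R, forall x1, 0 <= muK a f x1})
  (muK_neq0 : ~ {ae leb1 R, forall x1, j0 < x1 < j1 -> muK a f x1 = 0}) :
  let delta := fun x : R * R => `|x.1 - (j0 + j1) / 2| in
  exists2 cK : R, 0 < cK &
    forall (psi : R * R -> R[i]) (dpsi : 'I_2 -> R * R -> R[i]),
      H10_strip a psi dpsi ->
      ((\int[leb2 R]_(x in strip a)
           ((f x)^-1 * sqmod (dpsi ord0 x))%:E
         + \int[leb2 R]_(x in strip a)
             (muK a f x.1 * sqmod (psi x) * f x)%:E
        >= cK%:E * \int[leb2 R]_(x in strip a)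
             (sqmod (psi x) / (1 + delta x ^+ 2) * f x)%:E)%E
      /\
      (hK a f dpsi - (E1 a)%:E * sqnormf a f psi
        >= cK%:E * \int[leb2 R]_(x in strip a)
             (sqmod (psi x) / (1 + delta x ^+ 2) * f x)%:E)%E).
Proof.
have kpos : (0 <= normLoo a K)%E by exact: Lnorm_ge0.
have a2 : 0 < a ^+ 2 by rewrite exprn_gt0.
(* An infinite norm times [a ^+ 2 > 0] would be [+oo], against [K_small]. *)
have kfin : normLoo a K \is a fin_num.
  rewrite ge0_fin_numE//; case: (normLoo a K) kpos K_small => [r| |] //= _.
    by rewrite ltry.
  by rewrite gt0_mulye ?lte_fin.
pose kappa := fine (normLoo a K).
have Kk z : strip a z -> `|K z| <= kappa by move=> /K_bound; rewrite -lee_fin fineK.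
have kappa0 : 0 <= kappa by exact: fine_ge0.
have th2 : kappa * a ^+ 2 < 1 / 2 by rewrite -lte_fin EFinM fineK.
pose th := kappa * a ^+ 2.
have th0 : 0 <= th by rewrite mulr_ge0// ltW.
have th1 : th < 1 by apply: (lt_trans th2); lra.
have mK : measurable_fun (strip a : set (measurableTypeR R * measurableTypeR R)%type) K by exact: K_meas.
have jb x := jacobi_bound a_gt0 (measurable_slice2 x mK)
  (fun t ta => Kk (x, t) (strip_section x ta)) th1 (f_jacobi x).
have mf := measurable_jacobi a_gt0 mK Kk th1 f_jacobi.
pose q := th / (1 - th).
(* [th / (1 - th) < 1] amounts to [th < 1 / 2]: the smallness of [K] is what keeps [f >= 1 - q]
   positive. *)
have q1 : q < 1 by rewrite ltr_pdivrMr ?subr_gt0// mul1r; move: th2; rewrite -/th; lra.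
have fq z : strip a z -> `|f z - 1| <= q.
  by case: z => x t ta; apply: (jb x).1; rewrite /section/= in_itv.
have m0 : 0 < 1 - q by rewrite subr_gt0.
have fm z : strip a z -> 1 - q <= f z.
  by move=> /fq; rewrite ler_norml => /andP[+ _]; lra.
have fM z : strip a z -> f z <= 1 + q.
  by move=> /fq; rewrite ler_norml => /andP[_ +]; lra.
have fL x s t (hs : section a s) (ht : section a t) := (jb x).2 s t hs ht.
have mmu := measurable_muK a_gt0 m0 mf fm fM fL.
(* The level [1 / (n + 1)] found here plays the part of [eta]; the measure of [B], finite because
   the interval is bounded, plays that of [beta]. *)
have [n Bn] := positive_level_set mmu muK_ge0 muK_neq0.
set B := _ `&` _ in Bn.
have BJ : B `<=` `]j0, j1[%classic by move=> x [].
have mB : measurable (B : set (measurableTypeR R)).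
  exact: measurable_level_set.
have Bfin : leb1 R B \is a fin_num.
  rewrite ge0_fin_numE; last exact: measure_ge0.
  apply: (@le_lt_trans _ _ (leb1 R `]j0, j1[%classic)).
    by apply: le_measure => //; rewrite inE//; exact: measurable_itv.
  by rewrite /leb1 lebesgue_measure_itv/= lte_fin J_nonempty -EFinD ltry.
have BE : leb1 R B = (fine (leb1 R B))%:E by rewrite fineK.
have beta0 : 0 < fine (leb1 R B) by rewrite -lte_fin -BE.
have eta0 : 0 < n.+1%:R^-1 :> R by rewrite invr_gt0.
have etaB x : B x -> n.+1%:R^-1 <= muK a f x by move=> [].
move=> delta; exists (hardy_constant (1 - q) (1 + q) n.+1%:R^-1 j0 j1 (fine (leb1 R B))).
  exact: (hardy_constant_gt0 a_gt0 m0 fm fM eta0 (ltW J_nonempty) beta0).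
move=> psi dpsi hp; split; last exact: (hardy_form a_gt0 m0 mf fm fM eta0 mB etaB muK_ge0 (ltW J_nonempty) BJ BE).
apply: (le_trans (hardy_horizontal a_gt0 m0 mf fm fM eta0 mB etaB muK_ge0 (ltW J_nonempty) BJ BE beta0 hp)).
apply: leeD2l; exact: (muK_integral_ge a_gt0 m0 mf fm fM fL eta0 mB etaB muK_ge0 hp).
Qed.
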